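(* For every integer $k\geq 0$ there exists a constant $\varepsilon_0>0$ such that for every $0<\varepsilon\leq\varepsilon_0$ and every $\varepsilon$-structured pair $(G,(A,B,S))$, at least one of the following holds: 1. there is an anti-adjacent pair $(P,Q)$ in $G$ with $P,Q\subseteq S$ and $|P|,|Q|\geq\varepsilon|S|$; 2. there is an active $\ell$-hook $(X,R)$ in $G$ for some $\ell\geq k$ with $R\subseteq S$ and $|R|\geq 2\varepsilon|S|$; 3. there is a subset $\hat S\subseteq S$ with $|\hat S|\geq |S|/5$ and a partition $\hat S=S_1\uplus\cdots\uplus S_m$ into nonempty sets, for some $m\geq 2$, such that (a) $|S_i|\leq\varepsilon|S|$ for every $i$; (b) every $S_i$ is a module of $G[\hat S]$; and (c) the quotient graph of this partition of $G[\hat S]$ is claw-free and Berge.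
   Context: All graphs are finite and simple. $N(v)$ is the open neighbourhood, $N[v]=N(v)\cup\{v\}$, $N(X)$ is the set of vertices outside $X$ with a neighbour in $X$, and $N_S[v]=N[v]\cap S$. An $\varepsilon$-structured pair is a pair $(G,(A,B,S))$ where $A,B,S$ are nonempty sets partitioning $V(G)$, $G[A]$ and $G[B]$ are connected, $N(A)=N(B)=S$, and $|N_S[v]|\leq\varepsilon|S|$ for every $v\in V(G)$. For disjoint $P,Q$, $(P,Q)$ is anti-adjacent if there is no edge between $P$ and $Q$. For $\ell\geq 0$, the $\ell$-hook is the graph on $v_1,\ldots,v_{\ell+4}$ with edges $v_iv_{i+1}$ ($1\leq i\leq \ell+2$) and $v_{\ell+1}v_{\ell+4}$; $v_1$ is its active vertex. An active $\ell$-hook in $G$ is a pair $(X,R)$ of disjoint vertex sets such that $G[X]$ is isomorphic to the $\ell$-hook, $G[R]$ is connected, and $N(R)\cap X$ consists of exactly one vertex, the active vertex of $G[X]$ (the image of $v_1$). A set $M$ is a module of a graph $H$ if $N(x)\setminus M=N(y)\setminus M$ for all $x,y\in M$. For a partition of $V(H)$ into nonempty modules $X_1,\dots,X_r$, the quotient graph has vertex set $\{X_1,\ldots,X_r\}$ with $X_iX_j$ an edge iff every vertex of $X_i$ is adjacent to every vertex of $X_j$. Claw-free: no induced $K_{1,3}$. Berge: no induced odd cycle of length $\geq 5$ and no induced complement of such a cycle. *)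

(* Defs.v *)
From mathcomp Require Import all_boot all_order all_algebra.
From mathcomp Require Import reals.

Set Implicit Arguments.
Unset Strict Implicit.
Unset Printing Implicit Defensive.

Import Order.TTheory GRing.Theory Num.Theory.

(* A finite simple graph is a symmetric irreflexive relation on a finType. *)
Definition simple_graph (T : finType) (e : rel T) : Prop :=
  symmetric e /\ irreflexive e.

Definition nbhd (T : finType) (e : rel T) (v : T) : {set T} := [set u | e v u].

Definition cnbhd (T : finType) (e : rel T) (v : T) : {set T} := v |: nbhd e v.

Definition set_nbhd (T : finType) (e : rel T) (X : {set T}) : {set T} :=
  [set v | (v \notin X) && [exists u in X, e v u]].

Definition induced (T : finType) (e : rel T) (X : {set T}) :
  rel {x : T | x \in X} := relpre val e.
Arguments induced {T} e X.

(* The null graph counts as connected here; every set whose connectedness is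
   used below is nonempty. *)
Definition connected_graph (T : finType) (e : rel T) : Prop :=
  forall x y : T, connect e x y.

Definition graph_iso (T U : finType) (e : rel T) (d : rel U) (f : T -> U) :
  Prop := bijective f /\ {mono f : x y / e x y >-> d x y}.

Definition has_induced (T U : finType) (e : rel T) (d : rel U) : Prop :=
  exists f : U -> T, injective f /\ {mono f : x y / d x y >-> e x y}.

Definition anti_adjacent (T : finType) (e : rel T) (P Q : {set T}) : Prop :=
  [disjoint P & Q] /\ (forall p q, p \in P -> q \in Q -> ~~ e p q).

(* Vertex v_(i+1) is represented by the ordinal i. *)
Definition hook_arc (l : nat) (i j : 'I_l.+4) : bool :=
  ((j == i.+1 :> nat) && (i <= l.+1)) || ((i == l :> nat) && (j == l.+3 :> nat)).

Definition hook (l : nat) : rel 'I_l.+4 :=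
  fun i j => hook_arc i j || hook_arc j i.
Arguments hook l : clear implicits.

(* The isomorphism also selects the active vertex: for some l it is determined
   only up to an automorphism of the hook. *)
Definition active_hook (T : finType) (e : rel T) (l : nat) (X R : {set T}) :
  Prop :=
  [/\ [disjoint X & R],
      connected_graph (induced e R)
    & exists f : 'I_l.+4 -> {x : T | x \in X},
        graph_iso (hook l) (induced e X) f
        /\ set_nbhd e R :&: X = [set val (f ord0)]].

Definition is_module (T : finType) (e : rel T) (M : {set T}) : Prop :=
  forall x y, x \in M -> y \in M -> nbhd e x :\: M = nbhd e y :\: M.

Definition quotient_graph (T : finType) (e : rel T) (P : {set {set T}}) :
  rel {M : {set T} | M \in P} :=
  fun M N => (M != N) && [forall x in val M, forall y in val N, e x y].
Arguments quotient_graph {T} e P.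

Definition claw : rel 'I_4 := fun i j => (i == ord0) != (j == ord0).

Definition claw_free (T : finType) (e : rel T) : Prop := ~ has_induced e claw.

Definition cycle_graph (n : nat) : rel 'I_n :=
  fun i j => (j == ordS i) || (i == ordS j).
Arguments cycle_graph n : clear implicits.

Definition compl_graph (T : finType) (e : rel T) : rel T :=
  fun x y => (x != y) && ~~ e x y.

Definition berge (T : finType) (e : rel T) : Prop :=
  forall n : nat, odd n -> 5 <= n ->
    ~ has_induced e (cycle_graph n)
    /\ ~ has_induced e (compl_graph (cycle_graph n)).

Local Open Scope ring_scope.

(* Nonemptiness and disjointness are spelled out because
   [partition [set A; B; S] setT] would allow A = B. *)
Record structured_pair (R : realType) (eps : R) (T : finType) (e : rel T)
    (A B S : {set T}) : Prop := StructuredPair {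
  structured_simple : simple_graph e;
  structured_nonempty : [/\ A != set0, B != set0 & S != set0];
  structured_disjoint : [/\ [disjoint A & B], [disjoint A & S]
                          & [disjoint B & S]];
  structured_cover : A :|: B :|: S = [set: T];
  structured_connA : connected_graph (induced e A);
  structured_connB : connected_graph (induced e B);
  structured_nbhdA : set_nbhd e A = S;
  structured_nbhdB : set_nbhd e B = S;
  structured_small : forall v : T, #|cnbhd e v :&: S|%:R <= eps * #|S|%:R
}.

(* Main.v *)
Require Import Defs.
From mathcomp Require Import all_boot all_order all_algebra.
From mathcomp Require Import boolp reals.
From mathcomp Require Import lra zify.

(* A vertex v attached to a connected set W that dominates a constant proportion
   of S cannot be the second vertex of an induced path p - v - c - d whose other
   vertices are anticomplete to W: this path is a 0-hook, and if there is no
   anti-adjacent pair, a shortest path from v through W to a giant connected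
   piece of S, continued inside S, makes it a long hook.

   Choose connected X in A and Y in B, each dominating about a tenth of S, and
   stratify A and B by the distance to X and Y. A vertex x outside N(X) and N(Y)
   has a level lA x in A and lB x in B: the least rank of a neighbour. All
   neighbours of x in A have rank lA x or lA x + 1; hence, keeping the most
   frequent pair of parities of the levels (a set K of at least |S|/5 vertices),
   a neighbour of x of rank lA x is adjacent to another vertex of K only if the
   latter has the same level. Say that two vertices of K share if they have such
   a common neighbour in A. Excluding hooks attached through the lower layers of
   A or B shows that nonadjacent sharing vertices are twins, and that a common
   neighbour w of two nonadjacent, non-sharing vertices u and v shares with
   exactly one of them. The modules are generated by the nonadjacent sharing
   pairs. Edges of the quotient are thus 2-coloured (sharing or not), with
   different colours on wu and wv whenever u and v are nonadjacent; parity
   excludes claws, odd holes and odd antiholes. *)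

Set Implicit Arguments.
Unset Strict Implicit.
Unset Printing Implicit Defensive.

Import Order.TTheory GRing.Theory Num.Theory.

(** * Connected vertex sets *)

Section Connectivity.
Variables (T : finType) (e : rel T).
Hypothesis e_sym : symmetric e.

(** Connectedness by cuts: every [Z] that splits [W] is left by an edge of [W]. No paths in a
    subtype are needed; [connP] gives the equivalence. *)
Definition conn (W : {set T}) : Prop :=
  forall (Z : {set T}) x y, x \in W :&: Z -> y \in W :\: Z ->
  exists u v, [/\ u \in W :&: Z, v \in W :\: Z & e u v].

Lemma conn1 x : conn [set x].
Proof.
move=> Z y z; rewrite !inE => /andP[/eqP-> xZ] /andP[xNZ /eqP zx].
by rewrite zx xZ in xNZ.
Qed.

Lemma connU (W1 W2 : {set T}) u v : conn W1 -> conn W2 ->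
  u \in W1 -> v \in W2 -> e u v -> conn (W1 :|: W2).
Proof.
move=> c1 c2 uW vW euv Z x y.
pose cut := exists u v, [/\ u \in (W1 :|: W2) :&: Z,
  v \in (W1 :|: W2) :\: Z & e u v].
have cutW (W : {set T}) : conn W -> W \subset W1 :|: W2 ->
    forall a b, a \in W -> b \in W -> a \in Z -> b \notin Z -> cut.
  move=> cW /subsetP sW a b aW bW aZ bZ.
  have [||a' [b' [aW' bW' eab]]] := cW Z a b; rewrite ?inE ?aW ?aZ ?bZ //.
  exists a', b'; move: aW' bW'; rewrite !in_setI !in_setD.
  by move=> /andP[/sW-> ->] /andP[-> /sW->].
have cut1 := cutW _ c1 (subsetUl _ _); have cut2 := cutW _ c2 (subsetUr _ _).
rewrite !in_setI !in_setD !in_setU => /andP[xW xZ] /andP[yZ yW].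
have ecut a b : a \in W1 :|: W2 -> b \in W1 :|: W2 -> e a b ->
    a \in Z -> b \notin Z -> cut.
  by move=> aW bW eab aZ bZ; exists a, b; rewrite in_setI in_setD aW bW aZ bZ.
have uWW : u \in W1 :|: W2 by rewrite inE uW.
have vWW : v \in W1 :|: W2 by rewrite inE vW orbT.
have evu : e v u by rewrite e_sym.
case: (boolP (u \in Z)) (boolP (v \in Z)) => uZ [] vZ.
- by case/orP: yW => yW; [apply: (cut1 u y) | apply: (cut2 v y)].
- exact: (ecut u v).
- exact: (ecut v u).
- by case/orP: xW => xW; [apply: (cut1 x u) | apply: (cut2 x v)].
Qed.

Lemma connU1 (W : {set T}) w v : conn W -> w \in W -> e w v -> conn (v |: W).
Proof.
move=> cW wW ewv; rewrite setUC.
by apply: (@connU W [set v] w v) => //; [apply: conn1 | rewrite inE].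
Qed.

Lemma connP (W : {set T}) : conn W <-> connected_graph (induced e W).
Proof.
split=> [cW x y | cW Z x y].
  pose Z := [set val z | z in connect (induced e W) x].
  have xZ : val x \in Z by apply/imsetP; exists x => //; apply: connect0.
  case: (boolP (val y \in Z)) => [/imsetP[z xz /val_inj->] //|yZ].
  have [||u [v []]] := cW Z (val x) (val y).
  - by rewrite in_setI xZ (valP x).
  - by rewrite in_setD yZ (valP y).
  rewrite in_setI in_setD => /andP[_ /imsetP[z xz ->]] /andP[vZ vW] ezv.
  case/negP: vZ; apply/imsetP; exists (exist _ v vW) => //.
  by apply: connect_trans xz _; apply: connect1.
rewrite in_setI in_setD => /andP[xW xZ] /andP[yZ yW].
have /connectP[p] := cW (exist _ x xW) (exist _ y yW).
have : val (exist (fun x => x \in W) x xW) \in Z by [].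
have : val (exist (fun x => x \in W) y yW) \notin Z by [].
move: (exist _ x xW) (exist _ y yW) => {x y xW yW xZ yZ} x y yZ xZ.
elim: p x xZ => [|z p IHp] x xZ /=; first by move=> _ yx; rewrite yx xZ in yZ.
move=> /andP[exz pz] yl; case: (boolP (val z \in Z)) => zZ; first exact: IHp pz yl.
by exists (val x), (val z); rewrite in_setI in_setD xZ zZ (valP x) (valP z).
Qed.

(** [W] is the component of the graph on [X] that contains [R], grown by one neighbour at a time. *)
Lemma max_conn (R X : {set T}) : conn R -> R != set0 -> R \subset X ->
  exists W : {set T}, [/\ conn W, R \subset W, W \subset X &
    forall u v, u \in W -> e u v -> v \in X -> v \in W].
Proof.
move=> cR R0 RX.
have [n] := ubnP #|X :\: R|; elim: n => // n IHn in R cR R0 RX *.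
rewrite ltnS => leXR.
case: (boolP [exists u in R, [exists v in X :\: R, e u v]]).
  case/exists_inP=> u uR /exists_inP[v]; rewrite inE => /andP[vR vX] euv.
  have [|||| W [cW RW WX cl]] := IHn (v |: R).
  - exact: connU1 uR euv.
  - by apply/set0Pn; exists v; rewrite !inE eqxx.
  - by rewrite subUset sub1set vX.
  - apply: leq_trans leXR; apply: proper_card; apply/properP.
    split; first by apply: setDS; apply: subsetUr.
    by exists v; rewrite !inE ?vR ?vX ?eqxx.
  by exists W; split=> //; apply: subset_trans RW; apply: subsetUr.
move/exists_inPn=> cl; exists R; split=> // u v uR euv vX.
apply: contraTT euv => vR; have /exists_inPn := cl u uR; apply.
by rewrite inE vR.
Qed.

End Connectivity.

(** * Hooks attached to a connected set *)

Section HookExtension.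
Variables (T : finType) (e : rel T).
Hypotheses (e_sym : symmetric e) (e_irr : irreflexive e).

(** The hook is given by an embedding rather than by a vertex set, so that it can be lengthened at
    its active vertex [g ord0]. *)
Record attached (W : {set T}) l (g : 'I_l.+4 -> T) : Prop := Attached {
  attached_inj : injective g;
  attached_mono : forall i j, e (g i) (g j) = hook l i j;
  attached_conn : conn e W;
  attached_notin : forall i, g i \notin W;
  attached_only : forall w i, w \in W -> e w (g i) -> i = ord0;
  attached_ex : exists2 w, w \in W & e w (g ord0)
}.

Definition hook_cons l (v : T) (g : 'I_l.+4 -> T) (i : 'I_l.+1.+4) : T :=
  oapp g v (unlift ord0 i).

Lemma hook_cons0 l v (g : 'I_l.+4 -> T) : hook_cons v g ord0 = v.
Proof. by rewrite /hook_cons unlift_none. Qed.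

Lemma hook_consS l v (g : 'I_l.+4 -> T) i : hook_cons v g (lift ord0 i) = g i.
Proof. by rewrite /hook_cons liftK. Qed.

Lemma hook_lift l (i j : 'I_l.+4) :
  hook l.+1 (lift ord0 i) (lift ord0 j) = hook l i j.
Proof. by rewrite /hook /hook_arc !lift0 !eqSS !ltnS. Qed.

Lemma hook_lift0 l (j : 'I_l.+4) : hook l.+1 ord0 (lift ord0 j) = (j == ord0).
Proof. by rewrite /hook /hook_arc !lift0 /= !eqSS andbT !andbF !orbF. Qed.

Lemma hook_sym l : symmetric (hook l).
Proof. by move=> i j; rewrite /hook orbC. Qed.

Lemma hook_irr l : irreflexive (hook l).
Proof. by move=> i; apply/negbTE; rewrite /hook /hook_arc; lia. Qed.

(** Since [W] sees the hook only at [g ord0], the vertex [v] of [W] has no other neighbour in it and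
    can be prepended as the new active vertex. *)
Lemma attached_cons (W W' : {set T}) l (g : 'I_l.+4 -> T) v w :
  attached W g -> conn e W' -> W' \subset W -> v \in W -> v \notin W' ->
  e v (g ord0) -> w \in W' -> e w v -> (forall u, u \in W' -> ~~ e u (g ord0)) ->
  attached W' (hook_cons v g).
Proof.
move=> [ginj gmono cW gW gonly _] cW' /subsetP sW vW vW' evg wW' ewv nW'.
have gv i : g i != v by apply: contraNneq (gW i) => ->.
split=> //.
- move=> i j; case: (unliftP ord0 i) => [i'|] ->; case: (unliftP ord0 j) => [j'|] ->;
    rewrite ?hook_cons0 ?hook_consS //.
  + by move/ginj->.
  + by move/eqP; rewrite (negbTE (gv _)).
  + by move/esym/eqP; rewrite (negbTE (gv _)).
- have E0 j : e v (g j) = (j == ord0).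
    by apply/idP/eqP => [/(gonly _ _ vW)|->].
  move=> i j; case: (unliftP ord0 i) => [i'|] ->; case: (unliftP ord0 j) => [j'|] ->;
    rewrite ?hook_cons0 ?hook_consS ?hook_lift ?hook_lift0 ?hook_irr ?e_irr //.
  by rewrite hook_sym hook_lift0 e_sym.
- move=> i; case: (unliftP ord0 i) => [i'|] ->; rewrite ?hook_cons0 ?hook_consS //.
  by apply: contra (gW i'); apply: sW.
- move=> u i uW'; case: (unliftP ord0 i) => [i'|] -> //.
  rewrite hook_consS => eug; have i0 := gonly _ _ (sW _ uW') eug.
  by move: (nW' _ uW'); rewrite -i0 eug.
- by exists w; rewrite ?hook_cons0.
Qed.

(** The active vertex walks through [W] until it touches [R]. While [R] misses its neighbourhood,
    take the component [W'] of [R] in [W] minus that neighbourhood. An edge of [W] leaving [W']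
    ends, by maximality, in a neighbour [v] of the active vertex; prepend [v] and replace [W] by
    [W']. *)
Lemma attached_shrink (W R : {set T}) l (g : 'I_l.+4 -> T) :
  attached W g -> conn e R -> R != set0 -> R \subset W ->
  exists l' (g' : 'I_l'.+4 -> T), [/\ l <= l', attached R g' &
    (forall u, u \in R -> ~~ e u (g ord0)) -> l < l'].
Proof.
move=> aW cR R0; have [n] := ubnP #|W|; elim: n => // n IHn in W l g aW *.
rewrite ltnS => leW sRW.
have [/exists_inP[u uR eug]|/exists_inPn nR] := boolP [exists u in R, e u (g ord0)].
  exists l, g; split=> //; last by move=> /(_ u uR); rewrite eug.
  case: aW => ginj gmono _ gW gonly _; split=> //.
  - by move=> i; apply: contra (gW i); apply: (subsetP sRW).
  - by move=> w i /(subsetP sRW); apply: gonly.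
  - by exists u.
pose X := [set u in W | ~~ e u (g ord0)].
have sRX : R \subset X.
  by apply/subsetP=> u uR; rewrite inE (subsetP sRW) ?nR.
have [W' [cW' sRW' /subsetP sWX cl]] := max_conn e_sym cR R0 sRX.
have [w0 w0W ew0] := attached_ex aW.
have w0W' : w0 \notin W' by apply/negP=> /sWX; rewrite inE ew0 andbF.
have [r rR] := set0Pn _ R0.
have rW' := subsetP sRW' r rR.
have sW'W : W' \subset W by apply/subsetP=> u /sWX; rewrite inE => /andP[].
have [||u [v []]] := attached_conn aW (Z := W') (x := r) (y := w0).
- by rewrite inE rW' (subsetP sRW).
- by rewrite inE w0W' w0W.
rewrite inE in_setD => /andP[_ uW'] /andP[vW' vW] euv.
have evg : e v (g ord0).
  by apply: contraNT vW' => nev; apply: cl uW' euv _; rewrite inE vW.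
have aW' : attached W' (hook_cons v g).
  apply: (attached_cons aW cW' sW'W vW vW' evg uW' euv) => x /sWX.
  by rewrite inE => /andP[].
have [|l' [g' [ll' aR _]]] := IHn _ _ _ aW' _ sRW'.
  by apply: leq_trans leW; apply: proper_card; apply/properP; split=> //; exists w0.
by exists l', g'; split=> //; apply: ltnW.
Qed.

Lemma attached_active (R : {set T}) l (g : 'I_l.+4 -> T) :
  attached R g -> active_hook e l [set g i | i in setT] R.
Proof.
case=> ginj gmono cR gR gonly [w wR ewg].
have gX i : g i \in [set g i | i in setT] by apply: imset_f.
split.
- rewrite disjoint_subset; apply/subsetP=> _ /imsetP[i _ ->]; exact: gR.
- by apply/connP.
exists (fun i => exist _ (g i) (gX i)); split; last first.
  apply/setP=> x; rewrite !inE /=; apply/idP/eqP.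
    case/andP=> /andP[_ /exists_inP[u uR]] + /imsetP[i _ xg].
    by rewrite e_sym xg => /(gonly _ _ uR) ->.
  by move=> ->; rewrite gX gR andbT; apply/exists_inP; exists w; rewrite // e_sym.
split; last by move=> i j; rewrite /induced /= gmono.
apply: inj_card_bij; first by move=> i j [/ginj].
by rewrite card_sig (eq_card (B := [set g i | i in setT])) // card_imset // cardsT.
Qed.

(* An induced path [p - v - c - d] is a 0-hook with active vertex [v]. *)
Lemma attached_P4 (W : {set T}) v p c d : conn e W ->
  v \notin W -> p \notin W -> c \notin W -> d \notin W ->
  e v p -> e v c -> e c d -> ~~ e p c -> ~~ e p d -> ~~ e v d ->
  (exists2 w, w \in W & e w v) ->
  (forall w, w \in W -> [&& ~~ e w p, ~~ e w c & ~~ e w d]) ->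
  exists g : 'I_4 -> T, attached W (l := 0) g.
Proof.
move=> cW vW pW cNW dW evp evc ecd npc npd nvd [w wW ewv] nW.
have vp : v != p by apply: contraTneq evp => ->; rewrite e_irr.
have vc : v != c by apply: contraTneq evc => ->; rewrite e_irr.
have cd : c != d by apply: contraTneq ecd => ->; rewrite e_irr.
have pc : p != c by apply: contraNneq npd => ->.
have pd : p != d by apply: contraNneq npc => ->; rewrite e_sym.
have vd : v != d by apply: contraNneq npd => <-; rewrite e_sym.
(* For [l = 0] the extra edge from [v_(l+1)] to [v_(l+4)] starts at [v_1]: the path is [v, c, d],
   and [p] is the fourth vertex. *)
pose g (i : 'I_4) := nth v [:: v; c; d; p] i; exists g.
have gE i : [\/ i = inord 0, i = inord 1, i = inord 2 | i = inord 3 :> 'I_4].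
  case: i => -[|[|[|[|//]]]] ?; [constructor 1|constructor 2|constructor 3|constructor 4];
  by apply/val_inj; rewrite /= inordK.
split=> //.
- apply/injectiveP; rewrite /injectiveb /dinjectiveb /=.
  rewrite (_ : map g _ = [:: v; c; d; p]).
    by rewrite /= !inE !negb_or vc vd vp cd (eq_sym c) (eq_sym d) pc pd.
  by rewrite enum_ordSl /= !enum_ordSl /= (size0nil (size_enum_ord 0)).
- move=> i j; case: (gE i) => ->; case: (gE j) => ->; rewrite /g /hook /hook_arc !inordK //=;
  rewrite ?e_irr ?(negbTE npc) ?(negbTE npd) ?(negbTE nvd) ?evp ?evc ?ecd //;
  by rewrite e_sym ?(negbTE npc) ?(negbTE npd) ?(negbTE nvd) ?evp ?evc ?ecd.
- by move=> i; case: (gE i) => ->; rewrite /g inordK.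
- move=> u i uW; case: (gE i) => ->; rewrite /g inordK //= => eu; have := nW u uW;
    rewrite ?eu ?andbF //= => _.
  by apply/val_inj; rewrite /= inordK.
- by exists w.
Qed.

End HookExtension.

(** * Linking through a dominating connected set *)

Section Link.
Local Open Scope ring_scope.
Variables (R : realType) (eps : R) (k : nat) (T : finType) (e : rel T).
Variable S : {set T}.
Hypotheses (e_sym : symmetric e) (e_irr : irreflexive e).
Hypotheses (eps_gt0 : 0 < eps) (S_neq0 : S != set0).
Hypothesis eps_small : eps * (9 + 2 * k%:R) <= 1.
Local Notation N := (#|S|%:R : R).
Hypothesis S_small : forall v : T, #|cnbhd e v :&: S|%:R <= eps * N.
Hypothesis no_anti : forall P Q : {set T}, anti_adjacent e P Q ->
  P \subset S -> Q \subset S -> eps * N <= #|P|%:R -> ~ eps * N <= #|Q|%:R.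
Hypothesis no_hook : forall l (X Y : {set T}), (k <= l)%N ->
  active_hook e l X Y -> Y \subset S -> ~ 2 * eps * N <= #|Y|%:R.

Lemma N_gt0 : 0 < N.
Proof. by rewrite ltr0n card_gt0. Qed.

Lemma epsN_gt0 : 0 < eps * N.
Proof. by rewrite mulr_gt0 ?N_gt0. Qed.

Lemma card_setID_R (X Y : {set T}) :
  #|X|%:R = #|X :&: Y|%:R + #|X :\: Y|%:R :> R.
Proof. by rewrite -natrD cardsID. Qed.

Lemma ler_card (X Y : {set T}) : X \subset Y -> #|X|%:R <= #|Y|%:R :> R.
Proof. by move=> XY; rewrite ler_nat subset_leq_card. Qed.

(** A union of components of [X] is anti-adjacent to the rest of [X], so one of the two has fewer
    than [eps * N] vertices. Descend through such unions with small complement: if one splits, its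
    two parts cannot both be small, as [X] would have fewer than [3 * (eps * N)] vertices. The
    descent ends in a connected set. *)
Lemma big_conn (X : {set T}) : X \subset S -> 3 * (eps * N) <= #|X|%:R ->
  exists Z : {set T}, [/\ conn e Z, Z \subset X & #|X|%:R - eps * N <= #|Z|%:R].
Proof.
move=> XS leX; have eN := epsN_gt0.
pose closed (Z : {set T}) := Z \subset X /\
  (forall u v, u \in Z -> v \in X -> v \notin Z -> ~~ e u v).
have dich Z : closed Z -> #|X :\: Z|%:R < eps * N \/ #|Z|%:R < eps * N.
  case=> ZX cl; case: (ltP #|Z|%:R (eps * N)) => leZ; [by right | left].
  rewrite ltNge; apply/negP; apply: no_anti leZ => //.
  - split; first by rewrite disjoints_subset; apply/subsetP=> u uZ; rewrite !inE uZ.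
    by move=> u v uZ; rewrite inE => /andP[vZ vX]; apply: cl.
  - exact: subset_trans XS.
  - by apply: subset_trans XS; apply: subsetDl.
suff main n (Z : {set T}) : (#|Z| < n)%N -> closed Z -> #|X :\: Z|%:R < eps * N ->
    exists Z', [/\ conn e Z', Z' \subset X & #|X|%:R - eps * N <= #|Z'|%:R].
  apply: (main #|X|.+1 X) => //; last by rewrite setDv cards0.
  by split=> // u v _ vX; rewrite vX.
elim: n Z => // n IHn Z; rewrite ltnS => leZn [ZX clZ] ZD.
pose cut (Y : {set T}) := [&& Z :&: Y != set0, Z :\: Y != set0 &
  [forall u in Z :&: Y, forall v in Z :\: Y, ~~ e u v]].
case: (boolP [exists Y, cut Y]) => [/existsP[Y]|].
  case/and3P=> ZY1 ZY2 /forall_inP cutY.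
  have nocut u v : u \in Z :&: Y -> v \in Z :\: Y -> ~~ e u v.
    by move=> uZ; move: (cutY u uZ) => /forall_inP; apply.
  have cl1 : closed (Z :&: Y).
    split; first by apply: subset_trans ZX; apply: subsetIl.
    move=> u v uZ vX; rewrite inE negb_and; case: (boolP (v \in Z)) => vZ /= vY.
      by apply: nocut => //; rewrite inE vZ vY.
    by apply: clZ => //; move: uZ; rewrite inE => /andP[].
  have cl2 : closed (Z :\: Y).
    split; first by apply: subset_trans ZX; apply: subsetDl.
    move=> u v uZ vX; rewrite inE negb_and; case: (boolP (v \in Z)) => vZ /= vY.
      by rewrite e_sym; apply: nocut => //; rewrite inE vZ; move: vY; rewrite orbF negbK.
    by apply: clZ => //; move: uZ; rewrite inE => /andP[].
  have small (Y' : {set T}) : Y' \proper Z -> closed Y' -> #|X :\: Y'|%:R < eps * N ->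
      exists Z', [/\ conn e Z', Z' \subset X & #|X|%:R - eps * N <= #|Z'|%:R].
    by move=> pY clY; apply: IHn => //; apply: leq_trans leZn; apply: proper_card.
  case: (dich _ cl1) => [|lt1].
    apply: small => //; rewrite properE subsetIl /=; apply: contra ZY2.
    by rewrite subsetI subxx /= -setD_eq0.
  case: (dich _ cl2) => [|lt2].
    apply: small => //; rewrite properE subsetDl /=; apply: contra ZY1.
    rewrite subsetD subxx /= => /disjoint_setI0 ->; exact: eqxx.
  move: leX; rewrite (card_setID_R X Z) (setIidPr ZX) (card_setID_R Z Y).
  by move: ZD lt1 lt2; set a := #|_|%:R; set b := #|_|%:R; set c := #|_|%:R; lra.
move=> /existsPn ncut; exists Z; split=> //; last first.
  by rewrite (card_setID_R X Z) (setIidPr ZX); lra.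
move=> Y x y xZ yZ; have := ncut Y; rewrite /cut.
have -> : Z :&: Y != set0 by apply/set0Pn; exists x.
have -> : Z :\: Y != set0 by apply/set0Pn; exists y.
move=> /forall_inPn[u uZ /forall_inPn[v vZ euv]].
by exists u, v; rewrite uZ vZ; move: euv; rewrite negbK.
Qed.

Lemma card_setDcn (X : {set T}) v : X \subset S ->
  #|X|%:R - eps * N <= #|X :\: cnbhd e v|%:R.
Proof.
move=> XS; rewrite (card_setID_R X (cnbhd e v)).
have : #|X :&: cnbhd e v|%:R <= eps * N.
  apply: le_trans (S_small v); apply: ler_card.
  by rewrite setIC; apply: setIS.
lra.
Qed.

(** Here [d] counts possible extensions. Deleting the closed neighbourhood of the active vertex and
    passing to the giant connected piece costs [2 * (eps * N)] vertices of [Y] and lengthens the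
    hook by at least one. *)
Lemma no_attached d (Y : {set T}) l (g : 'I_l.+4 -> T) : attached e Y g ->
  Y \subset S -> (4 + 2 * d%:R) * (eps * N) <= #|Y|%:R -> (l + d < k)%N.
Proof.
have eN := epsN_gt0.
elim: d Y l g => [|d IHd] Y l g aY YS leY; rewrite ltnNge; apply/negP=> kl.
  apply: (no_hook _ (attached_active e_sym aY)) => //; last by lra.
  by move: kl; rewrite addn0.
have leX := card_setDcn (g ord0) YS.
have dN : 0 <= d%:R * (eps * N) by rewrite mulr_ge0 // ltW.
have dS : d.+1%:R = d%:R + 1 :> R by rewrite -addn1 natrD.
rewrite dS in leY.
have XS : Y :\: cnbhd e (g ord0) \subset S by apply: subset_trans YS; apply: subsetDl.
have [|Z [cZ ZX leZ]] := big_conn XS; first by lra.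
have ZY : Z \subset Y by apply: subset_trans ZX _; apply: subsetDl.
have Z0 : Z != set0.
  by rewrite -card_gt0 -(ltr_nat R); lra.
have [l' [g' [_ aZ ll']]] := attached_shrink e_sym e_irr aY cZ Z0 ZY.
have {}ll' : (l < l')%N.
  apply: ll' => u uZ; move/subsetP: ZX => /(_ u uZ); rewrite !inE negb_or => /andP[/andP[_ nu] _].
  by rewrite e_sym.
have : (l' + d < k)%N by apply: IHd aZ (subset_trans ZY YS) _; lra.
by rewrite ltnNge (leq_trans kl) // addnS -addSn leq_add2r.
Qed.

(* The vertices [p], [v], [c], [d] have at most [4 eps |S|] neighbours in [S];
   removing them leaves a connected piece of [S] that still meets [N(W)], and a
   shortest path from [v] through [W] to it turns the 0-hook into a long hook. *)
Lemma no_linked_P4 (W : {set T}) v p c d : conn e W ->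
  5 * (eps * N) < #|[set s in S | [exists w in W, e w s]]|%:R ->
  v \notin W -> p \notin W -> c \notin W -> d \notin W ->
  e v p -> e v c -> e c d -> ~~ e p c -> ~~ e p d -> ~~ e v d ->
  (exists2 w, w \in W & e w v) ->
  (forall w, w \in W -> [&& ~~ e w p, ~~ e w c & ~~ e w d]) -> False.
Proof.
move=> cW leW vW pW cNW dW evp evc ecd npc npd nvd [w wW ewv] nW.
have eN := epsN_gt0.
pose X := S :\: cnbhd e v :\: cnbhd e p :\: cnbhd e c :\: cnbhd e d.
have leX : N - 4 * (eps * N) <= #|X|%:R.
  have S1 : S :\: cnbhd e v \subset S by apply: subsetDl.
  have S2 : S :\: cnbhd e v :\: cnbhd e p \subset S.
    by apply: subset_trans S1; apply: subsetDl.
  have S3 : S :\: cnbhd e v :\: cnbhd e p :\: cnbhd e c \subset S.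
    by apply: subset_trans S2; apply: subsetDl.
  have := card_setDcn v (subxx S); have := card_setDcn p S1.
  have := card_setDcn c S2; have := card_setDcn d S3; rewrite -/X.
  by set a := #|_|%:R; set b := #|_|%:R; set f := #|_|%:R; set g := #|_|%:R; lra.
(* Of [9 + 2k], four closed neighbourhoods and the loss in [big_conn] use 5; the remaining [4 + 2k]
   is what [no_attached] asks for [k] extensions. *)
have kN : eps * N * (9 + 2 * k%:R) <= N.
  by rewrite mulrAC ger_pMl ?N_gt0.
have k0 : 0 <= eps * N * k%:R by rewrite mulr_ge0 // ltW.
have XS : X \subset S by rewrite /X !setDDl subsetDl.
have [|Y [cY YX leY]] := big_conn XS; first by lra.
have YS := subset_trans YX XS.
have Ynot u : u \in Y -> [&& u \notin cnbhd e v, u \notin cnbhd e p,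
    u \notin cnbhd e c & u \notin cnbhd e d].
  move/(subsetP YX); rewrite /X !in_setD.
  by case/andP=> -> /andP[-> /andP[-> /andP[-> _]]].
have Y0 : Y != set0 by rewrite -card_gt0 -(ltr_nat R); lra.
have [y [u [uW yY euy]]] : exists y u, [/\ u \in W, y \in Y & e u y].
  set NW := [set s in S | _] in leW.
  (* [Y] misses at most [5 * (eps * N)] vertices of [S], and [NW] has more. *)
  have : ~~ [disjoint NW & Y].
    apply/negP=> dis; move: (leq_card_setU NW Y).2.
    rewrite dis => /eqP cU.
    have : #|NW :|: Y|%:R <= N.
      apply: ler_card; rewrite subUset YS andbT.
      by apply/subsetP=> s; rewrite inE => /andP[].
    by rewrite cU natrD; lra.
  by move=> /pred0Pn[y] /=; rewrite inE -andbA => /and3P[_ /exists_inP[u]]; exists y, u.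
have cWY := connU e_sym cW cY uW yY euy.
have vY : v \notin Y by apply/negP=> /Ynot; rewrite !inE eqxx.
have pY : p \notin Y by apply/negP=> /Ynot; rewrite !inE eqxx /= andbF.
have cNY : c \notin Y by apply/negP=> /Ynot; rewrite !inE eqxx /= !andbF.
have dY : d \notin Y by apply/negP=> /Ynot; rewrite !inE eqxx /= !andbF.
have [||||||g ag] := @attached_P4 T e e_sym e_irr (W :|: Y) v p c d cWY _ _ _ _
  evp evc ecd npc npd nvd; rewrite ?inE ?negb_or ?vW ?vY ?pW ?pY ?cNW ?cNY ?dW ?dY //.
- by exists w; rewrite // inE wW.
- move=> a /setUP[/nW //|/Ynot]; rewrite !inE !negb_or (e_sym a p) (e_sym a c) (e_sym a d).
  by case/and4P=> _ /andP[_ ->] /andP[_ ->] /andP[_ ->].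
have [l [g' [_ aY _]]] := attached_shrink e_sym e_irr ag cY Y0 (subsetUr _ _).
suff : (l + k < k)%N by rewrite ltnNge leq_addl.
by apply: no_attached aY YS _; lra.
Qed.

End Link.

(** * Layered sides *)

(** Adjacent vertices of a side have ranks differing by at most one; so for two levels of equal
    parity, vertices at these ranks are nonadjacent unless the levels coincide. *)
Lemma odd_gap m n : odd m = odd n -> m < n -> m.+1 < n.
Proof.
move=> par lt; rewrite ltn_neqAle lt andbT.
by apply/eqP=> mn; move: par; rewrite -mn /=; case: (odd m).
Qed.

Lemma odd_squeeze m n : odd m = odd n -> m <= n -> n <= m.+1 -> m = n.
Proof.
move=> par; rewrite leq_eqVlt => /predU1P[//|/(odd_gap par) lt1 lt2].
by rewrite ltnNge lt2 in lt1.
Qed.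

Section Sides.
Variables (T : finType) (e : rel T) (S : {set T}) (big : {set T} -> Prop).
Hypotheses (e_sym : symmetric e) (e_irr : irreflexive e).
Hypothesis big_sub : forall W W' : {set T}, W \subset W' -> big W -> big W'.

Definition far (W : {set T}) z := (z \notin W) && [forall w in W, ~~ e w z].

(** In the application [big W] says that [W] dominates more than [5 eps |S|] vertices of [S], and
    this is [no_linked_P4]. *)
Hypothesis no_link : forall (W : {set T}) v p c d, conn e W -> big W ->
  v \notin W -> (exists2 w, w \in W & e w v) ->
  far W p -> far W c -> far W d ->
  e v p -> e v c -> e c d -> ~~ e p c -> ~~ e p d -> ~~ e v d -> False.

(** With the strict inequality, [ball A r 1] is the seed of rank 0 and [ball A r (r a)] the layers
    strictly below [a]. *)
Definition ball (A : {set T}) (r : T -> nat) n := [set a in A | r a < n].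

(* In the instance of interest, [r a] is the distance in [A] from a fixed
   connected subset and [lam x] is the least rank of a neighbour of [x]. *)
Record side (A : {set T}) (r lam : T -> nat) : Prop := Side {
  side_disj : forall a, a \in A -> a \notin S;
  side_conn : forall n, conn e (ball A r n);
  side_big : big (ball A r 1);
  side_parent : forall a, a \in A -> 0 < r a ->
    exists u, [/\ u \in A, e a u & r a = (r u).+1];
  side_lip : forall a a', a \in A -> a' \in A -> e a a' -> r a <= (r a').+1;
  side_ex : forall x, x \in S -> exists a, [/\ a \in A, e x a & r a = lam x];
  side_le : forall x a, x \in S -> a \in A -> e x a -> lam x <= r a
}.

Record layered (A B : {set T}) (rA lA rB lB : T -> nat) (K : {set T}) : Prop := Layered {
  layA : side A rA lA;
  layB : side B rB lB;
  lay_anti : forall a b, a \in A -> b \in B -> ~~ e a b;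
  lay_disj : forall a, a \in A -> a \notin B;
  layK : forall x, x \in K -> x \in S;
  lay_posA : forall x, x \in K -> 0 < lA x;
  lay_posB : forall x, x \in K -> 0 < lB x;
  lay_oddA : forall x y, x \in K -> y \in K -> odd (lA x) = odd (lA y);
  lay_oddB : forall x y, x \in K -> y \in K -> odd (lB x) = odd (lB y)
}.

Lemma layered_sym A B rA lA rB lB K :
  layered A B rA lA rB lB K -> layered B A rB lB rA lA K.
Proof.
case=> sA sB AB dAB KS pA pB oA oB; split=> //.
  by move=> b a bB aA; rewrite e_sym AB.
by move=> b bB; apply/negP=> /dAB; rewrite bB.
Qed.

Definition share (A : {set T}) (r lam : T -> nat) x y :=
  [exists a in A, [&& e x a, e y a, r a == lam x & r a == lam y]].

Lemma share_sym A r lam : symmetric (share A r lam).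
Proof.
by move=> x y; apply/exists_inP/exists_inP=> -[a aA /and4P[h1 h2 h3 h4]];
  exists a => //; apply/and4P.
Qed.

(** * Configurations excluded by linking through the lower layers of [B] *)

Section OneSide.
Variables (A B : {set T}) (rA lA rB lB : T -> nat) (K : {set T}).
Hypothesis lay : layered A B rA lA rB lB K.
Let sA := layA lay.
Let sB := layB lay.

(** The standard linking set: connected through a parent of [b], big if [b] has positive rank, and
    far from all of [A] and from every vertex of [S] that is nonadjacent to [b] and of level at
    least [rB b]. *)
Definition upset (b : T) := b |: ball B rB (rB b).

Lemma big_ball n : 0 < n -> big (ball B rB n).
Proof.
move=> n0; apply: big_sub (side_big sB).
by apply/subsetP=> b; rewrite !inE => /andP[-> /leq_trans->].
Qed.

Lemma upset_conn b : b \in B -> 0 < rB b -> conn e (upset b).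
Proof.
move=> bB b0; have [u [uB ebu ru]] := side_parent sB bB b0.
apply: (@connU1 _ e e_sym _ u); first exact: side_conn sB _.
  by rewrite inE uB ru /=.
by rewrite e_sym.
Qed.

Lemma upset_big b : 0 < rB b -> big (upset b).
Proof. by move=> b0; apply: big_sub (big_ball b0); apply: subsetUr. Qed.

Lemma upset_B b w : b \in B -> w \in upset b -> (w \in B) && (rB w <= rB b).
Proof. by move=> bB /setU1P[->|]; rewrite ?bB ?leqnn // inE => /andP[-> /ltnW]. Qed.

Lemma far_A b a : b \in B -> a \in A -> far (upset b) a.
Proof.
move=> bB aA; apply/andP; split.
  by apply: contra (lay_disj lay aA) => /(upset_B bB)/andP[].
by apply/forall_inP=> w /(upset_B bB)/andP[wB _]; rewrite e_sym (lay_anti lay).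
Qed.

Lemma notin_S b x : b \in B -> x \in S -> x \notin upset b.
Proof.
by move=> bB xS; apply: contraTN xS => /(upset_B bB)/andP[/(side_disj sB)].
Qed.

Lemma far_S b x : b \in B -> x \in S -> rB b <= lB x -> ~~ e x b -> far (upset b) x.
Proof.
move=> bB xS le nxb; apply/andP; split; first exact: notin_S.
apply/forall_inP=> w /setU1P[->|]; first by rewrite e_sym.
rewrite inE => /andP[wB ltw]; rewrite e_sym.
by apply: contraTN ltw => /(side_le sB xS wB) lew; rewrite -leqNgt (leq_trans le).
Qed.

Lemma far_S_lt b x : b \in B -> x \in S -> rB b < lB x -> far (upset b) x.
Proof.
move=> bB xS lt; apply: far_S => //; first exact: ltnW.
by apply/negP=> /(side_le sB xS bB); rewrite leqNgt lt.
Qed.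

Lemma far_B b b' : b \in B -> b' \in B -> (rB b).+1 < rB b' -> far (upset b) b'.
Proof.
move=> bB b'B lt; apply/andP; split.
  by apply/negP=> /(upset_B bB)/andP[_]; rewrite leqNgt (ltnW lt).
apply/forall_inP=> w /(upset_B bB)/andP[wB le]; rewrite e_sym.
apply/negP=> /(side_lip sB b'B wB); rewrite leqNgt => /negP; apply.
by apply: leq_ltn_trans lt; rewrite ltnS.
Qed.

Lemma farU1 W x z : z \notin x |: W -> ~~ e x z -> far W z -> far (x |: W) z.
Proof.
move=> zxW nxz /andP[_ /forall_inP fW]; apply/andP; split=> //.
by apply/forall_inP=> w /setU1P[->|/fW].
Qed.

Lemma far_ball a n : a \in A -> far (ball B rB n) a.
Proof.
move=> aA; rewrite /far inE (negbTE (lay_disj lay aA)).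
by apply/forall_inP=> w; rewrite inE => /andP[wB _]; rewrite e_sym (lay_anti lay).
Qed.

Lemma far_ballS n x : x \in S -> n <= lB x -> far (ball B rB n) x.
Proof.
move=> xS le; apply/andP; split.
  by rewrite inE; apply: contraTN xS => /andP[/(side_disj sB)].
apply/forall_inP=> w; rewrite inE => /andP[wB ltw]; rewrite e_sym.
by apply/negP=> /(side_le sB xS wB); rewrite leqNgt (leq_trans ltw le).
Qed.

Lemma upset_link b v p c d : b \in B -> 0 < rB b -> v \in S -> e v b ->
  far (upset b) p -> far (upset b) c -> far (upset b) d ->
  e v p -> e v c -> e c d -> ~~ e p c -> ~~ e p d -> ~~ e v d -> False.
Proof.
move=> bB b0 vS evb; apply: no_link; first exact: upset_conn.
- exact: upset_big.
- exact: notin_S.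
- by exists b; rewrite ?setU11 // e_sym.
Qed.

Lemma nadj_low x a : x \in K -> a \in A -> rA a < lA x -> ~~ e x a.
Proof.
move=> xK aA lt; apply/negP=> /(side_le sA (layK lay xK) aA).
by rewrite leqNgt lt.
Qed.

Lemma nadj_gap a a' : a \in A -> a' \in A -> (rA a').+1 < rA a -> ~~ e a a'.
Proof. by move=> aA a'A lt; apply/negP=> /(side_lip sA aA a'A); rewrite leqNgt lt. Qed.

Lemma parent x a : x \in K -> a \in A -> rA a = lA x ->
  exists u, [/\ u \in A, e a u & lA x = (rA u).+1].
Proof.
move=> xK aA ra; rewrite -ra; apply: (side_parent sA aA).
by rewrite ra (lay_posA lay).
Qed.

Lemma gapA x z : x \in K -> z \in K -> lA z < lA x -> (lA z).+1 < lA x.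
Proof. by move=> xK zK; apply: odd_gap; apply: (lay_oddA lay). Qed.

Lemma gapB x z : x \in K -> z \in K -> lB z < lB x -> (lB z).+1 < lB x.
Proof. by move=> xK zK; apply: odd_gap; apply: (lay_oddB lay). Qed.

(* Otherwise [x] would be the centre of a claw with leaves in [B], at rank
   [> lA x + 1], and at rank [lA x], the last leg being extended by a parent. *)
Lemma nadj_high x a2 : x \in K -> a2 \in A -> (lA x).+1 < rA a2 -> ~~ e x a2.
Proof.
move=> xK a2A lt; apply/negP=> exa2.
have xS := layK lay xK.
have [a [aA exa ra]] := side_ex sA xS.
have [b [bB exb rb]] := side_ex sB xS.
have [u [uA eau ru]] := parent xK aA ra.
have b0 : 0 < rB b by rewrite rb (lay_posB lay).
apply: (upset_link bB b0 xS exb (far_A bB a2A) (far_A bB aA) (far_A bB uA)) => //.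
- by rewrite nadj_gap ?ra.
- by rewrite nadj_gap // -ru ltnW.
- by rewrite nadj_low // ru.
Qed.

(** The level of [w] is at most the rank of [a], and by [nadj_high] at least this rank minus one;
    parity makes it equal. *)
Lemma share_key x w a : x \in K -> w \in K -> a \in A -> e x a ->
  rA a = lA x -> e w a -> share A rA lA x w.
Proof.
move=> xK wK aA exa ra ewa; apply/exists_inP; exists a => //.
rewrite exa ewa ra eqxx /= eq_sym; apply/eqP/odd_squeeze.
- exact: lay_oddA lay _ _ wK xK.
- by rewrite -ra (side_le sA (layK lay wK)).
- by rewrite leqNgt -ra; apply: contraL ewa => /(nadj_high wK aA)->.
Qed.

(** Otherwise the path [y - b - x - a], with [b] the shared neighbour in [B], is linked through the
    layers below [b]. *)
Lemma share_twins x y a : x \in K -> y \in K -> ~~ e x y ->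
  share B rB lB x y -> a \in A -> e x a -> e y a.
Proof.
move=> xK yK nxy /exists_inP[b bB /and4P[exb eyb /eqP rx /eqP ry]] aA exa.
apply/negPn/negP=> nya; have b0 : 0 < rB b by rewrite rx (lay_posB lay).
have [u [uB ebu ru]] := side_parent sB bB b0.
apply: (no_link (W := ball B rB (rB b)) (v := b) (p := y) (c := x) (d := a)) => //.
- exact: side_conn sB _.
- exact: big_ball.
- by rewrite inE ltnn andbF.
- by exists u; rewrite 1?e_sym // inE uB ru /=.
- by apply: far_ballS; rewrite ?(layK lay) // ry.
- by apply: far_ballS; rewrite ?(layK lay) // rx.
- exact: far_ball.
- by rewrite e_sym.
- by rewrite e_sym.
- by rewrite e_sym.
- by rewrite e_sym (lay_anti lay).
Qed.

(** The path [y - b - x - z] must fail to be induced; the level of [z] keeps it far from the layers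
    below the shared [b], so [z] is adjacent to [b]. *)
Lemma share_distinguish x y z : x \in K -> y \in K -> z \in K -> ~~ e x y ->
  share B rB lB x y -> e x z -> ~~ e y z -> lB x <= lB z -> exists b,
  [/\ b \in B, e y b, rB b = lB y & e z b].
Proof.
move=> xK yK zK nxy /exists_inP[b bB /and4P[exb eyb /eqP rx /eqP ry]] exz nyz le.
exists b; split=> //; apply/negPn/negP=> nzb.
have b0 : 0 < rB b by rewrite rx (lay_posB lay).
have [u [uB ebu ru]] := side_parent sB bB b0.
apply: (no_link (W := ball B rB (rB b)) (v := b) (p := y) (c := x) (d := z)) => //.
- exact: side_conn sB _.
- exact: big_ball.
- by rewrite inE ltnn andbF.
- by exists u; rewrite 1?e_sym // inE uB ru /=.
- by apply: far_ballS; rewrite ?(layK lay) // ry.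
- by apply: far_ballS; rewrite ?(layK lay) // rx.
- by apply: far_ballS; rewrite ?(layK lay) // rx.
- by rewrite e_sym.
- by rewrite e_sym.
- by rewrite e_sym.
- by rewrite e_sym.
Qed.

(** The path [az - z - x - ax] through lowest neighbours in [A] is induced by the parity gap, and is
    linked through a lowest neighbour of [z] in [B]. *)
Lemma lower_neighbour x z : x \in K -> z \in K -> e x z ->
  lA z < lA x -> lB z < lB x -> False.
Proof.
move=> xK zK exz ltA ltB; have xS := layK lay xK; have zS := layK lay zK.
have [az [azA ezaz raz]] := side_ex sA zS.
have [ax [axA exax rax]] := side_ex sA xS.
have [b [bB ezb rb]] := side_ex sB zS.
have gap := gapA xK zK ltA.
apply: (@upset_link b z az x ax) => //; try exact: far_A.
- by rewrite rb (lay_posB lay).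
- by apply: far_S_lt; rewrite ?rb.
- by rewrite e_sym.
- by rewrite e_sym nadj_low ?raz.
- by rewrite e_sym nadj_gap ?raz ?rax.
- by rewrite nadj_high ?rax.
Qed.

(** The first hypothesis is [nadj_high] with the sides exchanged. If [x] were lower than [s] in [B],
    then [x] together with [upset b] would link the path [b' - s - a - u], where [u] is a parent of
    [a]. *)
Lemma shared_level x s a :
  (forall b, b \in B -> (lB x).+1 < rB b -> ~~ e x b) -> x \in K -> s \in K -> e x s -> lA x = lA s ->
  a \in A -> e s a -> rA a = lA s -> ~~ e x a -> lB s <= lB x.
Proof.
move=> nadj_highB xK sK exs lxs aA esa ra nxa; rewrite leqNgt; apply/negP=> lt.
have xS := layK lay xK; have sS := layK lay sK.
have [u [uA eau ru]] := parent sK aA ra.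
have [b [bB exb rb]] := side_ex sB xS.
have [b' [b'B esb' rb']] := side_ex sB sS.
have b0 : 0 < rB b by rewrite rb (lay_posB lay).
have gap := gapB sK xK lt.
have AneqS c : c \in A -> c != x.
  by move=> cA; apply: contraTneq cA => ->; apply/negP=> /(side_disj sA); rewrite xS.
have fA c : c \in A -> ~~ e x c -> far (x |: upset b) c.
  move=> cA nxc; apply: farU1 (far_A bB cA) => //.
  by rewrite in_setU1 negb_or AneqS //=; case/andP: (far_A bB cA).
have fb' : far (upset b) b' by apply: far_B; rewrite ?rb ?rb'.
apply: (no_link (W := x |: upset b) (v := s) (p := b') (c := a) (d := u)) => //.
- apply: (@connU1 _ e e_sym _ b); rewrite ?setU11 // 1?e_sym //.
  exact: upset_conn.
- by apply: big_sub (upset_big b0); apply: subsetUr.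
- by rewrite in_setU1 negb_or notin_S // andbT; apply: contraTneq exs => ->; rewrite e_irr.
- by exists x; rewrite ?setU11.
- apply: (farU1 _ _ fb'); last by rewrite nadj_highB ?rb'.
  rewrite in_setU1 negb_or; case/andP: fb' => -> _; rewrite andbT.
  by apply: contraTneq xS => <-; apply: (side_disj sB).
- exact: fA.
- by apply: fA; rewrite ?nadj_low // lxs ru.
- by rewrite e_sym (lay_anti lay).
- by rewrite e_sym (lay_anti lay).
- by rewrite nadj_low // ru.
Qed.

(** Otherwise [y - s - a - u], with [u] a parent of [a], is linked through [upset b]. *)
Lemma shared_neighbour s y a b : s \in K -> y \in K -> e s y -> lA y = lA s ->
  a \in A -> e s a -> rA a = lA s -> ~~ e y a ->
  b \in B -> e s b -> rB b = lB s -> lB s <= lB y -> e y b.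
Proof.
move=> sK yK esy lys aA esa ra nya bB esb rb le; apply/negPn/negP=> nyb.
have yS := layK lay yK; have sS := layK lay sK.
have [u [uA eau ru]] := parent sK aA ra.
apply: (@upset_link b s y a u) => //; try exact: far_A.
- by rewrite rb (lay_posB lay).
- by apply: far_S; rewrite ?rb.
- by rewrite nadj_low // lys ru.
- by rewrite nadj_low // ru.
Qed.

(** A lowest neighbour [ay] of [y] in [A] misses [z] by [share_key]. The path is [z - y - ay - u],
    [u] a parent of [ay], if [y] is not above [z] in [A], and [ay - y - z - az] otherwise. *)
Lemma cross_link_mid y z b : y \in K -> z \in K -> e y z ->
  ~~ share A rA lA y z -> b \in B -> 0 < rB b -> rB b <= lB z ->
  e y b -> ~~ e z b -> False.
Proof.
move=> yK zK eyz nsh bB b0 le eyb nzb.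
have yS := layK lay yK; have zS := layK lay zK.
have [ay [ayA eyay ray]] := side_ex sA yS.
have nzay : ~~ e z ay by apply: contra nsh; apply: share_key.
case: (leqP (lA y) (lA z)) => lt.
  have [u [uA eau ru]] := parent yK ayA ray.
  apply: (@upset_link b y z ay u) => //; try exact: far_A.
  - exact: far_S.
  - by rewrite nadj_low // -ru.
  - by rewrite nadj_low // ru.
have [az [azA ezaz raz]] := side_ex sA zS.
have gap := gapA yK zK lt.
apply: (@upset_link b y ay z az) => //; try exact: far_A.
- exact: far_S.
- by rewrite e_sym.
- by rewrite nadj_gap ?raz ?ray.
- by rewrite nadj_low ?raz.
Qed.

(** If [x] is below [y] in [A], the path [ax - x - y - ay] is linked through [upset b]. Otherwise
    [x] joins the linking set and the path is centred at [y] as in [cross_link_mid]. *)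
Lemma cross_link_end x y z b : x \in K -> y \in K -> z \in K ->
  e x y -> e y z -> ~~ e x z ->
  ~~ share A rA lA x y -> ~~ share A rA lA y z -> ~~ share A rA lA x z ->
  b \in B -> 0 < rB b -> rB b <= lB y -> rB b <= lB z ->
  e x b -> ~~ e y b -> ~~ e z b -> False.
Proof.
move=> xK yK zK exy eyz nxz nsxy nsyz nsxz bB b0 ley lez exb nyb nzb.
have xS := layK lay xK; have yS := layK lay yK; have zS := layK lay zK.
have [ax [axA exax rax]] := side_ex sA xS.
have [ay [ayA eyay ray]] := side_ex sA yS.
have [az [azA ezaz raz]] := side_ex sA zS.
have nxay : ~~ e x ay.
  by apply: contra nsxy; rewrite share_sym; apply: share_key.
have nzay : ~~ e z ay by apply: contra nsyz; apply: share_key.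
have nxaz : ~~ e x az.
  by apply: contra nsxz; rewrite share_sym; apply: share_key.
case: (ltnP (lA x) (lA y)) => ltxy.
  apply: (@upset_link b x ax y ay) => //; try exact: far_A.
  - exact: far_S.
  - by rewrite e_sym nadj_low ?rax.
  - by rewrite e_sym nadj_gap ?rax ?ray // gapA.
have AneqS c : c \in A -> c != x.
  by move=> cA; apply: contraTneq cA => ->; apply/negP=> /(side_disj sA); rewrite xS.
have fA c : c \in A -> ~~ e x c -> far (x |: upset b) c.
  move=> cA nxc; apply: farU1 (far_A bB cA) => //.
  by rewrite in_setU1 negb_or AneqS //=; case/andP: (far_A bB cA).
have fz : far (x |: upset b) z.
  apply: farU1 (far_S bB zS lez nzb) => //.
  rewrite in_setU1 negb_or notin_S // andbT.
  by apply: contraNneq nsxz => ->; apply: (share_key xK xK axA exax rax exax).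
have cW : conn e (x |: upset b).
  apply: (@connU1 _ e e_sym _ b); rewrite ?setU11 // 1?e_sym //.
  exact: upset_conn.
have bW : big (x |: upset b).
  by apply: big_sub (upset_big b0); apply: subsetUr.
have yW : y \notin x |: upset b.
  by rewrite in_setU1 negb_or notin_S // andbT; apply: contraTneq exy => ->; rewrite e_irr.
have exW : exists2 w, w \in x |: upset b & e w y by exists x; rewrite ?setU11.
case: (ltnP (lA z) (lA y)) => ltzy.
  apply: (no_link cW bW yW exW (fA ay ayA nxay) fz (fA az azA nxaz)) => //.
  - by rewrite e_sym.
  - by rewrite nadj_gap ?raz ?ray // gapA.
  - by rewrite nadj_low ?raz.
have [u [uA eau ru]] := parent yK ayA ray.
have nxu : ~~ e x u by rewrite nadj_low // -ru.
apply: (no_link cW bW yW exW fz (fA ay ayA nxay) (fA u uA nxu)) => //.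
- by rewrite nadj_low // -ru.
- by rewrite nadj_low // ru.
Qed.

End OneSide.

(** * Exchanging the two sides *)

Section TwoSides.
Variables (A B : {set T}) (rA lA rB lB : T -> nat) (K : {set T}).
Hypothesis lay : layered A B rA lA rB lB K.
Let layS := layered_sym lay.

(** The two vertices are twins towards [B], so a lowest neighbour of [x] in [B] is also adjacent to
    [y]. *)
Lemma share_transfer x y : x \in K -> y \in K -> ~~ e x y ->
  share A rA lA x y -> share B rB lB x y.
Proof.
move=> xK yK nxy sh; have [b [bB exb rb]] := side_ex (layB lay) (layK lay xK).
apply: (share_key layS xK yK bB exb rb).
exact: (share_twins layS xK yK nxy sh bB exb).
Qed.

Lemma share_nbhdB x y b : x \in K -> y \in K -> ~~ e x y ->
  share A rA lA x y -> b \in B -> e x b = e y b.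
Proof.
move=> xK yK nxy sh bB; apply/idP/idP; first exact: (share_twins layS).
by apply: (share_twins layS) => //; rewrite 1?e_sym // share_sym.
Qed.

End TwoSides.

(** * Sharing as an alternating colouring of edges *)

Section Types.
Variables (A B : {set T}) (rA lA rB lB : T -> nat) (K : {set T}).
Hypothesis lay : layered A B rA lA rB lB K.
Let layS := layered_sym lay.

Lemma share_nbhdA x y a : x \in K -> y \in K -> ~~ e x y ->
  share A rA lA x y -> a \in A -> e x a = e y a.
Proof.
by move=> xK yK nxy /(share_transfer lay xK yK nxy); apply: (share_nbhdB layS).
Qed.

(** By [lower_neighbour], [z] is at least as high as [x] on one of the sides; there
    [share_distinguish] yields a neighbour shared by [y] and [z]. *)
Lemma distinguish_share x y z : x \in K -> y \in K -> z \in K -> ~~ e x y ->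
  share A rA lA x y -> e x z -> ~~ e y z -> share A rA lA y z.
Proof.
move=> xK yK zK nxy sh exz nyz.
have shB := share_transfer lay xK yK nxy sh.
case: (leqP (lB x) (lB z)) => leB.
  have [b [bB eyb rb ezb]] := share_distinguish lay xK yK zK nxy shB exz nyz leB.
  apply: (share_transfer layS yK zK nyz).
  exact: (share_key layS yK zK bB eyb rb ezb).
case: (leqP (lA x) (lA z)) => leA.
  have [a [aA eya ra eza]] := share_distinguish layS xK yK zK nxy sh exz nyz leA.
  exact: (share_key lay yK zK aA eya ra eza).
by case: (lower_neighbour lay xK zK exz leA leB).
Qed.

(** Let [a] and [b], both in [A], witness that [s] shares with [x] and with [y]. If neither serves
    [x] and [y], then [s] is lowest of the three in [B], and a lowest neighbour of [s] in [B] is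
    adjacent to both, so they share in [B] and hence in [A]. *)
Lemma share_link x s y : x \in K -> s \in K -> y \in K -> ~~ e x y ->
  e s x -> e s y -> share A rA lA s x -> share A rA lA s y -> share A rA lA x y.
Proof.
move=> xK sK yK nxy esx esy /exists_inP[a aA /and4P[esa exa /eqP ras /eqP rax]].
case/exists_inP=> b bA /and4P[esb eyb /eqP rbs /eqP rby].
case: (boolP (e y a)) => [|nya]; first exact: (share_key lay xK yK aA exa rax).
case: (boolP (e x b)) => [exb|nxb].
  by rewrite share_sym; apply: (share_key lay yK xK bA eyb rby exb).
have exs : e x s by rewrite e_sym.
have eys : e y s by rewrite e_sym.
have lxs : lA x = lA s by rewrite -rax.
have lys : lA y = lA s by rewrite -rby.
have highB z : z \in K -> forall c, c \in B -> (lB z).+1 < rB c -> ~~ e z c.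
  by move=> zK c; apply: (nadj_high layS).
have lesx := shared_level lay (highB x xK) xK sK exs lxs bA esb rbs nxb.
have lesy := shared_level lay (highB y yK) yK sK eys lys aA esa ras nya.
have [c [cB esc rc]] := side_ex (layB lay) (layK lay sK).
have eyc := shared_neighbour lay sK yK esy lys aA esa ras nya cB esc rc lesy.
have exc := shared_neighbour lay sK xK esx lxs bA esb rbs nxb cB esc rc lesx.
apply: (share_transfer layS xK yK nxy).
have rcx : rB c = lB x.
  have /exists_inP[? _ /and4P[_ _ /eqP r1 /eqP r2]] :=
    share_key layS sK xK cB esc rc exc.
  by rewrite rc -r1.
exact: (share_key layS xK yK cB exc rcx eyc).
Qed.

(** If no pair shares, take a vertex of least level in [B] and a lowest neighbour [b] of it there.
    This vertex is an end of the path, and the other end misses [b]; conclude by [cross_link_mid] or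
    [cross_link_end] according to whether [y] is adjacent to [b]. *)
Lemma cross_link x y z : x \in K -> y \in K -> z \in K -> ~~ e x z ->
  e y x -> e y z -> ~~ share A rA lA x z ->
  share A rA lA y x || share A rA lA y z.
Proof.
move=> xK yK zK nxz eyx eyz nsxz; apply/negPn/negP; rewrite negb_or.
case/andP=> nsyx nsyz.
have nsxy : ~~ share A rA lA x y by rewrite share_sym.
have nszy : ~~ share A rA lA z y by rewrite share_sym.
have nszx : ~~ share A rA lA z x by rewrite share_sym.
have nzx : ~~ e z x by rewrite e_sym.
have exy : e x y by rewrite e_sym.
have ezy : e z y by rewrite e_sym.
have nsB : ~~ share B rB lB x z.
  by apply: contra nsxz; apply: (share_transfer layS).
have levB p q b : p \in K -> q \in K -> b \in B -> e p b -> rB b = lB p ->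
    e q b -> lB q = lB p.
  move=> pK qK bB epb rb eqb.
  have /exists_inP[c _ /and4P[_ _ /eqP <- /eqP <-]] //:=
    share_key layS pK qK bB epb rb eqb.
(* Were [y] lowest, its [b] would miss [x] or [z], which do not share in [B], against
   [cross_link_mid]. *)
have midmin : ~~ (lB y <= lB x) || ~~ (lB y <= lB z).
  rewrite -negb_and; apply/negP=> /andP[leyx leyz].
  have [b [bB eyb rb]] := side_ex (layB lay) (layK lay yK).
  have b0 : 0 < rB b by rewrite rb (lay_posB lay).
  case: (boolP (e z b)) => ezb.
    apply: (cross_link_mid lay yK xK eyx nsyx bB b0 _ eyb); first by rewrite rb.
    apply: contra nsB => exb; apply: (share_key layS xK zK bB exb _ ezb).
    by rewrite rb; apply/esym; apply: (levB y x b).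
  by apply: (cross_link_mid lay yK zK eyz nsyz bB b0 _ eyb ezb); rewrite rb.
case: (leqP (lB x) (lB y)) => lexy; last first.
  move: midmin; rewrite (ltnW lexy) /= -ltnNge => lezy.
  have [b [bB ezb rb]] := side_ex (layB lay) (layK lay zK).
  have b0 : 0 < rB b by rewrite rb (lay_posB lay).
  have nxb : ~~ e x b.
    apply: contraTN lexy => exb; rewrite -leqNgt.
    by rewrite (levB z x b) // ltnW.
  case: (boolP (e y b)) => eyb.
    apply: (cross_link_mid lay yK xK eyx nsyx bB b0 _ eyb nxb).
    by rewrite rb (ltnW (ltn_trans lezy lexy)).
  apply: (cross_link_end lay zK yK xK ezy eyx nzx nszy nsyx nszx bB b0 _ _ ezb eyb nxb);
    rewrite rb; first exact: ltnW.
  exact: ltnW (ltn_trans lezy lexy).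
case: (leqP (lB x) (lB z)) => lexz.
  have [b [bB exb rb]] := side_ex (layB lay) (layK lay xK).
  have b0 : 0 < rB b by rewrite rb (lay_posB lay).
  have nzb : ~~ e z b by apply: contra nsB; apply: (share_key layS xK zK bB exb rb).
  case: (boolP (e y b)) => eyb.
    by apply: (cross_link_mid lay yK zK eyz nsyz bB b0 _ eyb nzb); rewrite rb.
  by apply: (cross_link_end lay xK yK zK exy eyz nxz nsxy nsyz nsxz bB b0 _ _ exb eyb nzb);
    rewrite rb.
have [b [bB ezb rb]] := side_ex (layB lay) (layK lay zK).
have b0 : 0 < rB b by rewrite rb (lay_posB lay).
have nxb : ~~ e x b.
  by apply: contra nsB; rewrite share_sym; apply: (share_key layS zK xK bB ezb rb).
case: (boolP (e y b)) => eyb.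
  by apply: (cross_link_mid lay yK xK eyx nsyx bB b0 _ eyb nxb); rewrite rb ltnW.
by apply: (cross_link_end lay zK yK xK ezy eyx nzx nszy nsyx nszx bB b0 _ _ ezb eyb nxb);
  rewrite rb ltnW // (leq_trans lexz).
Qed.

Lemma share_alternate u v w : u \in K -> v \in K -> w \in K -> ~~ e u v ->
  ~~ share A rA lA u v -> e w u -> e w v ->
  share A rA lA w u = ~~ share A rA lA w v.
Proof.
move=> uK vK wK nuv nsuv ewu ewv; have := cross_link uK wK vK nuv ewu ewv nsuv.
case: (boolP (share A rA lA w u)) => [shu _|_ /= -> //].
apply/esym/negP => shv.
by case/negP: nsuv; apply: (share_link uK wK vK nuv ewu ewv shu shv).
Qed.

End Types.
End Sides.

(** * Alternating colourings *)

(** For a graph [d] and symmetric [s], this is a proper 2-colouring of the Gallai graph of [d]. *)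
Definition alternating (U : finType) (d s : rel U) : Prop :=
  forall u v w, u != v -> ~~ d u v -> d w u -> d w v -> s w u = ~~ s w v.

Lemma claw_not_alternating (s : rel 'I_4) : ~ alternating claw s.
Proof.
move=> alt; pose i m := (inord m : 'I_4).
have dE m : 0 < m < 4 -> claw ord0 (i m).
  by case/andP=> m0 m4; rewrite /claw eqxx -val_eqE /= inordK // eqn0Ngt m0.
have nd m m' : 0 < m < 4 -> 0 < m' < 4 -> ~~ claw (i m) (i m').
  case/andP=> m0 m4 /andP[m'0 m'4].
  by rewrite /claw -!val_eqE /= !inordK // !eqn0Ngt m0 m'0.
have neq m m' : m < 4 -> m' < 4 -> m != m' -> i m != i m'.
  by move=> m4 m'4; rewrite -val_eqE /= !inordK.
have h m m' : 0 < m < 4 -> 0 < m' < 4 -> m != m' -> s ord0 (i m) = ~~ s ord0 (i m').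
  move=> m4 m'4 mm'; apply: alt; rewrite ?dE ?nd // neq //.
    by case/andP: m4.
  by case/andP: m'4.
have := h 1 2 isT isT isT; rewrite (h 1 3) // (h 2 3) //.
by case: (s _ _).
Qed.

Section Cycles.
Variable n : nat.
Hypotheses (n_odd : odd n) (n_ge5 : 5 <= n).

Let n_gt0 : 0 < n. Proof. exact: leq_trans n_ge5. Qed.
(** Indexing the cycle by all naturals modulo [n] lets a local step be shifted and iterated past the
    wrap-around. *)
Let a m : 'I_n := iter m (@ordS n) (Ordinal n_gt0).

Lemma val_iter_ordS m : val (a m) = m %% n.
Proof. by elim: m => [|m IHm] /=; rewrite ?mod0n // IHm -addn1 modnDml addn1. Qed.

Lemma iter_ordS_eq m p q : (a (m + p) == a (m + q)) = (p == q %[mod n]).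
Proof. by rewrite -val_eqE !val_iter_ordS eqn_modDl. Qed.

Lemma cycle_graph_iter m p q : cycle_graph n (a (m + p)) (a (m + q)) =
  (q == p.+1 %[mod n]) || (p == q.+1 %[mod n]).
Proof.
by rewrite /cycle_graph -[ordS (a (m + p))]/(a (m + p).+1)
  -[ordS (a (m + q))]/(a (m + q).+1) -!addnS !iter_ordS_eq.
Qed.

Let small m : m < 5 -> m %% n = m.
Proof. by move=> lt; rewrite modn_small // (leq_trans lt). Qed.

(** Consecutive edges differ in colour, so an odd tour returns to the first edge with the wrong
    colour. *)
Lemma cycle_not_alternating (s : rel 'I_n) : symmetric s ->
  ~ alternating (cycle_graph n) s.
Proof.
move=> ssym alt.
have step m : s (a m.+1) (a m.+2) = ~~ s (a m) (a m.+1).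
  have := @alt (a (m + 0)) (a (m + 2)) (a (m + 1)).
  rewrite !iter_ordS_eq !cycle_graph_iter !small // !addnS !addn0.
  by rewrite [s (a m) _]ssym => -> //; rewrite negbK.
have all m : s (a m) (a m.+1) = odd m (+) s (a 0) (a 1).
  by elim: m => [|m IHm]; rewrite ?step ?IHm //= addNb.
have := all n; rewrite n_odd.
have a0 p : a (n + p) = a p.
  by apply: val_inj; rewrite !val_iter_ordS modnDl.
by rewrite -addn1 a0 -[in a n](addn0 n) a0; case: (s _ _).
Qed.

(** Moving one end of a chord to a consecutive vertex flips its colour. Two such moves show that all
    chords of length two have the same colour ([step], [const]). Moving the far end of a chord at
    [a 0] from [a 2] to [a (n - 2)] takes [n - 4] flips, an odd number, yet joins two such
    chords. *)
Lemma cycle_compl_not_alternating (s : rel 'I_n) : symmetric s ->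
  ~ alternating (compl_graph (cycle_graph n)) s.
Proof.
move=> ssym alt.
have altE m p q r : ~~ (p == q %[mod n]) ->
    (q == p.+1 %[mod n]) || (p == q.+1 %[mod n]) ->
    ~~ [|| r == p %[mod n], p == r.+1 %[mod n] | r == p.+1 %[mod n]] ->
    ~~ [|| r == q %[mod n], q == r.+1 %[mod n] | r == q.+1 %[mod n]] ->
    s (a (m + r)) (a (m + p)) = ~~ s (a (m + r)) (a (m + q)).
  rewrite !negb_or => npq apq /and3P[h1 h2 h3] /and3P[h4 h5 h6].
  apply: alt; rewrite /compl_graph ?iter_ordS_eq ?cycle_graph_iter ?npq ?apq //.
  - by rewrite h1 negb_or h2 h3.
  - by rewrite h4 negb_or h5 h6.
have step m : s (a m.+1) (a m.+3) = s (a m) (a m.+2).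
  have := altE m 0 1 3; have := altE m 2 3 0.
  rewrite !small // !addnS !addn0 => /(_ isT isT isT isT) -> /(_ isT isT isT isT).
  by rewrite [s (a m) _]ssym => ->; rewrite negbK ssym.
have const m : s (a m) (a m.+2) = s (a 0) (a 2) by elim: m => // m; rewrite step.
have f m : m + 4 <= n -> s (a 0) (a m.+2) = odd m (+) s (a 0) (a 2).
  elim: m => // m IHm lt; have ltn : m + 4 < n by [].
  rewrite /= addNb -IHm ?(ltnW lt) //.
  have sm p : p <= m + 4 -> p %% n = p by move=> le; rewrite modn_small // (leq_ltn_trans le).
  have s0 : 0 %% n = 0 by apply: sm; lia.
  have s1 : 1 %% n = 1 by apply: sm; lia.
  have s2 : m.+2 %% n = m.+2 by apply: sm; lia.
  have s3 : m.+3 %% n = m.+3 by apply: sm; lia.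
  have s4 : m.+4 %% n = m.+4 by apply: sm; lia.
  have := altE 0 m.+2 m.+3 0; rewrite !add0n s0 s1 s2 s3 s4 eqxx /=.
  by rewrite !eqSS (ltn_eqF (ltnSn m)) => -> //; rewrite negbK.
have n4 : (n - 4) + 4 = n by rewrite subnK // ltnW.
have := f (n - 4); rewrite n4 leqnn => /(_ isT).
have an p : a (n + p) = a p by apply: val_inj; rewrite !val_iter_ordS modnDl.
have nE : n = (n - 4).+2.+2 by rewrite -[LHS]n4 !addnS addn0.
have := const (n - 4).+2; rewrite -nE -[in a n](addn0 n) an ssym => ->.
have -> : odd (n - 4) = true by move: n_odd; rewrite -[in odd n]n4 oddD addbF.
by move: (s (a 0) (a 2)); case.
Qed.

End Cycles.

(** * Twin classes *)

Section Twins.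
Variables (T : finType) (e : rel T) (K : {set T}) (sh : rel T).
Hypotheses (e_sym : symmetric e) (e_irr : irreflexive e) (sh_sym : symmetric sh).
Hypothesis sh_dist : forall x y z, x \in K -> y \in K -> z \in K ->
  ~~ e x y -> sh x y -> e x z -> ~~ e y z -> sh y z.
Hypothesis sh_alt : forall u v w, u \in K -> v \in K -> w \in K ->
  ~~ e u v -> ~~ sh u v -> e w u -> e w v -> sh w u = ~~ sh w v.

Local Notation V := {x : T | x \in K}.
Local Notation eK := (induced e K).

Definition twin : rel V :=
  fun x y => [&& x != y, ~~ e (val x) (val y) & sh (val x) (val y)].

Definition twin_classes : {set {set V}} :=
  equivalence_partition (connect twin) [set: V].

Lemma twin_sym : symmetric twin.
Proof. by move=> x y; rewrite /twin eq_sym e_sym sh_sym. Qed.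

Lemma twin_connect_sym : connect_sym twin.
Proof. exact: sym_connect_sym twin_sym. Qed.

Lemma twin_equiv : {in [set: V] & &, equivalence_rel (connect twin)}.
Proof.
move=> x y z _ _ _; split; first exact: connect0.
by move=> xy; apply: same_connect twin_connect_sym _ _ xy z.
Qed.

Lemma twin_partition : partition twin_classes [set: V].
Proof. exact: equivalence_partitionP twin_equiv. Qed.

Lemma twin_classE M x : M \in twin_classes -> x \in M ->
  forall y, (y \in M) = connect twin x y.
Proof.
case/imsetP=> z _ ->; rewrite !inE /= => zx y; rewrite !inE /=.
exact: same_connect twin_connect_sym _ _ zx y.
Qed.

(** A vertex distinguishing two twins is, by [sh_dist], itself a twin of the one it misses, so it
    lies in the class; induct along a chain of twins. *)
Lemma twin_class_eq_nbr x y z : connect twin x y -> ~~ connect twin x z ->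
  e (val x) (val z) = e (val y) (val z).
Proof.
case/connectP=> p; elim: p x => [|w p IHp] x /=; first by move=> _ ->.
case/andP=> xw pw yl nxz.
have nwz : ~~ connect twin w z.
  by apply: contra nxz; apply: connect_trans (connect1 xw).
rewrite -(IHp w) //.
have half u v : twin u v -> ~~ connect twin v z -> e (val u) (val z) -> e (val v) (val z).
  move=> /and3P[uv nuv suv] nvz euz; apply/negPn/negP=> nevz.
  case/negP: nvz; apply: connect1; rewrite /twin nevz.
  rewrite (sh_dist (valP u) (valP v) (valP z) nuv suv euz nevz) !andbT /=.
  by apply: contraNneq nuv => ->.
apply/idP/idP; first exact: half.
by apply: half; rewrite 1?twin_sym.
Qed.

Lemma twin_class_module M : M \in twin_classes -> is_module eK M.
Proof.
move=> PM x y xM yM; apply/setP=> z; rewrite !inE.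
case: (boolP (z \in M)) => //= zM; rewrite /induced /=.
apply: twin_class_eq_nbr; first by rewrite -(twin_classE PM xM).
by rewrite -(twin_classE PM xM).
Qed.

(** Choose a representative in each class and colour by [sh]. The classes are modules, so
    representatives are adjacent exactly when their classes are; nonadjacent representatives of
    distinct classes do not share, and [sh_alt] applies. *)
Lemma quotient_alternating (U : finType) (d : rel U) :
  has_induced (quotient_graph eK twin_classes) d ->
  exists s : rel U, symmetric s /\ alternating d s.
Proof.
case=> f [finj fmono].
have fP u : val (f u) \in twin_classes := valP (f u).
have [_ trivP ne0] := and3P twin_partition.
have f0 u : exists x, x \in val (f u).
  by apply/set0Pn; apply: contraNneq ne0 => <-; apply: fP.
have /fin_all_exists[g gM] := f0.
have fneq u v : u != v -> g v \notin val (f u).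
  move=> uv; have fuv : val (f u) != val (f v) by rewrite val_eqE (inj_eq finj).
  have /trivIsetP/(_ _ _ (fP u) (fP v) fuv) dis := trivP.
  by rewrite (disjointFl dis).
have dE u v : u != v -> d u v = e (val (g u)) (val (g v)).
  move=> uv; rewrite -fmono /quotient_graph (inj_eq finj) uv /=.
  apply/forall_inP/idP => [/(_ _ (gM u))/forall_inP/(_ _ (gM v)) //|euv x xM].
  apply/forall_inP=> y yM; rewrite /induced /=.
  have vu : v != u by rewrite eq_sym.
  have nx : ~~ connect twin (g v) x.
    rewrite -(twin_classE (fP v) (gM v)); apply: contraNN (fneq _ _ uv) => xv.
    have xg := twin_classE (fP u) xM; rewrite xg -(twin_classE (fP v) xv) //.
  rewrite -(@twin_class_eq_nbr (g u)).
  - rewrite e_sym -(@twin_class_eq_nbr (g v)) 1?e_sym //.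
      by rewrite -(twin_classE (fP v) (gM v)).
    rewrite -(twin_classE (fP v) (gM v)); exact: fneq.
  - by rewrite -(twin_classE (fP u) (gM u)).
  - rewrite -(twin_classE (fP u) (gM u)); apply: contra nx => yu.
    rewrite twin_connect_sym -(twin_classE (fP u) xM).
    by move: (fneq _ _ vu); rewrite (twin_classE (fP v) yM) -(twin_classE (fP u) yu) gM.
exists (fun u v => sh (val (g u)) (val (g v))); split; first by move=> u v; apply: sh_sym.
have dirr u : d u u = false by rewrite -fmono /quotient_graph eqxx.
move=> u v w uv nduv dwu dwv.
have wu : w != u by apply: contraTneq dwu => ->; rewrite dirr.
have wv : w != v by apply: contraTneq dwv => ->; rewrite dirr.
have ngg : g u != g v by apply: contraNneq (fneq _ _ uv) => <-.
apply: sh_alt; rewrite ?(valP (g _)) -?dE //.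
apply: contra (fneq _ _ uv) => suv; rewrite (twin_classE (fP u) (gM u)).
by apply: connect1; rewrite /twin ngg -dE // nduv suv.
Qed.

Lemma twin_quotient_claw_free : claw_free (quotient_graph eK twin_classes).
Proof. by move=> /quotient_alternating[s [_ /claw_not_alternating]]. Qed.

Lemma twin_quotient_berge : berge (quotient_graph eK twin_classes).
Proof.
move=> n n_odd n5; split=> /quotient_alternating[s [ssym]].
  exact: cycle_not_alternating.
exact: cycle_compl_not_alternating.
Qed.

End Twins.

(** * Ranks *)

Section Ranks.
Variables (T : finType) (e : rel T) (S : {set T}) (big : {set T} -> Prop).
Hypotheses (e_sym : symmetric e).
Variables (A T0 : {set T}).
Hypotheses (A_conn : connected_graph (induced e A)) (A_nbhd : set_nbhd e A = S).
Hypotheses (T0_conn : conn e T0) (T0_neq0 : T0 != set0) (T0_sub : T0 \subset A).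
Hypothesis (T0_big : big T0).

Definition grow (X : {set T}) := X :|: [set a in A | [exists u in X, e u a]].

Let bl n := iter n grow T0.

Lemma bl_sub n : bl n \subset A.
Proof.
elim: n => //= n IHn; rewrite subUset IHn /=.
by apply/subsetP=> a; rewrite inE => /andP[].
Qed.

Lemma blS n a u : a \in A -> u \in bl n -> e u a -> a \in bl n.+1.
Proof.
move=> aA un eua; rewrite /= !inE aA orbC; apply/orP; left.
by apply/exists_inP; exists u.
Qed.

Lemma blP n a : a \in bl n.+1 -> a \in bl n \/ exists2 u, u \in bl n & e u a.
Proof.
rewrite /= inE => /orP[|]; [by left | rewrite inE => /andP[_ /exists_inP[u]]].
by right; exists u.
Qed.

Lemma bl_mono m n : m <= n -> bl m \subset bl n.
Proof.
move/subnK<-; elim: (n - m) => //= i; move/subset_trans; apply; exact: subsetUl.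
Qed.

(** The vertices of the new layer are added one by one, each having a neighbour in [bl n]; hence the
    claim for arbitrary subsets [Y]. *)
Lemma bl_conn n : conn e (bl n).
Proof.
elim: n => // n IHn.
have add (Y : {set T}) : Y \subset bl n.+1 -> conn e (bl n :|: Y).
  have [m] := ubnP #|Y|; elim: m Y => // m IHm Y; rewrite ltnS => leY sY.
  have [->|[y yY]] := set_0Vmem Y; first by rewrite setU0.
  have sY' : Y :\ y \subset bl n.+1 by apply: subset_trans sY; apply: subsetDl.
  have cY' : conn e (bl n :|: Y :\ y).
    by apply: IHm sY'; rewrite (cardsD1 y) yY in leY.
  rewrite -(setD1K yY) setUCA; have /blP[yn|[u un euy]] := subsetP sY y yY.
    by rewrite (setUidPr _) // sub1set inE yn.
  by apply: connU1 cY' _ euy => //; rewrite inE un.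
rewrite (_ : bl n.+1 = bl n :|: bl n.+1); first exact: add.
by apply/esym/setUidPr; apply: bl_mono.
Qed.

Lemma bl_reach a : a \in A -> exists n, a \in bl n.
Proof.
move=> aA; have [t tT] := set0Pn _ T0_neq0.
have tA := subsetP T0_sub t tT.
have /connectP[p] := A_conn (exist _ t tA) (exist _ a aA).
have : val (exist (fun x => x \in A) t tA) \in bl 0 by [].
move: (exist _ t tA) => {t tT tA} t; move: 0.
elim: p t => [|u p IHp] t n tn /=; first by move=> _ /(congr1 val) /= ->; exists n.
move=> /andP[etu pu] pl; apply: (IHp u n.+1) => //.
exact: blS (valP u) tn etu.
Qed.

Lemma rank_exists : exists r : T -> nat,
  forall a n, a \in A -> (a \in bl n) = (r a <= n).
Proof.
suff /fin_all_exists[r rP] : forall a, exists m, forall n, a \in A ->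
    (a \in bl n) = (m <= n) by exists r.
(* Outside [A] the rank is a default 0. *)
move=> a; case: (boolP (a \in A)) => aA; last by exists 0.
case: (ex_minnP (bl_reach aA)) => m am mmin; exists m => n _.
by apply/idP/idP=> [/mmin //|/bl_mono/subsetP->].
Qed.

(** The last clause makes levels positive once the vertices dominated by the seed are removed. *)
Lemma side_exists : exists r lam, side e S big A r lam /\
  forall x, x \in S -> lam x = 0 -> exists2 w, w \in T0 & e w x.
Proof.
have [r rP] := rank_exists.
have AS a : a \in A -> a \notin S by rewrite -A_nbhd inE => ->.
have nb x : x \in S -> exists n, [exists a in A, e x a && (r a == n)].
  rewrite -A_nbhd inE => /andP[_ /exists_inP[a aA exa]].
  by exists (r a); apply/exists_inP; exists a; rewrite ?exa /=.
have /fin_all_exists[lam lamP] : forall x, exists n, x \in S ->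
    [exists a in A, e x a && (r a == n)] /\ forall a, a \in A -> e x a -> n <= r a.
  move=> x; case: (boolP (x \in S)) => xS; last by exists 0.
  case: (ex_minnP (nb x xS)) => m am mmin; exists m => _; split=> // a aA exa.
  by apply: mmin; apply/exists_inP; exists a; rewrite ?exa /=.
have ballE n : ball A r n.+1 = bl n.
  apply/setP=> a; rewrite inE ltnS; case: (boolP (a \in A)) => aA; first by rewrite rP.
  by apply/esym; apply: contraNF aA; apply: (subsetP (bl_sub n)).
have stepr a a' : a \in A -> a' \in A -> e a a' -> r a <= (r a').+1.
  move=> aA a'A eaa'; rewrite -rP //; apply: (blS aA (u := a')); last by rewrite e_sym.
  by rewrite rP.
exists r, lam; split; last first.
  move=> x xS l0; have [/exists_inP[a aA /andP[exa]]] := lamP x xS.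
  rewrite l0 -leqn0 -rP // => aT _; exists a; rewrite // e_sym //.
split=> //.
- case=> [|n]; last by rewrite ballE; apply: bl_conn.
  by move=> Z x y; rewrite !inE ltn0 !andbF.
- by rewrite ballE.
- move=> a aA; case ra : (r a) => [//|m] _.
  have : a \in bl m.+1 by rewrite rP // ra.
  case/blP=> [|[u um eua]]; first by rewrite rP // ra ltnn.
  have uA := subsetP (bl_sub m) u um.
  exists u; rewrite uA e_sym eua; split=> //; congr _.+1; apply/eqP.
  by rewrite eqn_leq -[r u <= m]rP // um andbT -ltnS -ra stepr // e_sym.
- move=> x xS; have [/exists_inP[a aA /andP[exa /eqP ra]] _] := lamP x xS.
  by exists a.
- by move=> x a xS aA exa; have [_] := lamP x xS; apply.
Qed.

End Ranks.

(** * The theorem *)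

Local Open Scope ring_scope.

(** Grow a connected set from one vertex to [A]. The number of dominated vertices rises by at most
    [b] per step and ends at [|S|], above [c], so it cannot jump over the window of length [b]. *)
Lemma seed_exists (R : realType) (c b : R) (T : finType) (e : rel T) (S A : {set T}) :
  symmetric e -> connected_graph (induced e A) -> A != set0 ->
  set_nbhd e A = S ->
  (forall v, #|cnbhd e v :&: S|%:R <= b) -> c + b < #|S|%:R -> 0 < b -> b <= c ->
  exists X : {set T}, [/\ conn e X, X != set0, X \subset A &
    c - b < #|[set s in S | [exists w in X, e w s]]|%:R <= c].
Proof.
move=> e_sym cA A0 AS small lt b0 bc.
have cA' : conn e A by apply/connP.
pose NS (X : {set T}) := [set s in S | [exists w in X, e w s]].
have NSU (X : {set T}) v : #|NS (v |: X)|%:R <= #|NS X|%:R + b.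
  apply: (@le_trans _ _ (#|NS X|%:R + #|cnbhd e v :&: S|%:R)); last by rewrite lerD2l.
  rewrite -natrD ler_nat; apply: leq_trans (leq_card_setU _ _); apply: subset_leq_card.
  apply/subsetP=> s; rewrite !inE => /andP[sS /exists_inP[w /setU1P[->|wX] ews]].
    by rewrite sS ews !orbT.
  by rewrite sS; apply/orP; left; apply/exists_inP; exists w.
have NSA : NS A = S.
  apply/setP=> s; rewrite inE; case: (boolP (s \in S)) => //=.
  rewrite -AS inE => /andP[_ /exists_inP[a aA esa]].
  by apply/exists_inP; exists a; rewrite // e_sym.
suff main n (X : {set T}) : (#|A :\: X| < n)%N -> conn e X -> X != set0 ->
    X \subset A -> #|NS X|%:R <= c -> exists Y : {set T},
    [/\ conn e Y, Y != set0, Y \subset A & c - b < #|NS Y|%:R <= c].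
  have [a aA] := set0Pn _ A0; apply: (main #|A :\: [set a]|.+1 [set a]) => //.
  - exact: conn1.
  - by apply/set0Pn; exists a; rewrite inE.
  - by rewrite sub1set.
  have := NSU set0 a; rewrite setU0.
  have -> : NS set0 = set0.
    apply/setP=> s; rewrite !inE; apply/negbTE; rewrite negb_and orbC.
    by apply/orP; left; apply/exists_inPn=> w; rewrite inE.
  by rewrite cards0 add0r => /le_trans; apply.
elim: n X => // n IHn X; rewrite ltnS => leX cX X0 XA leN.
case: (ltP (c - b) #|NS X|%:R) => ltN; first by exists X; rewrite ltN leN.
have XneqA : X != A.
  by apply: contraTneq ltN => ->; rewrite NSA -ltNge; lra.
have [x xX] := set0Pn _ X0.
have /properP[_ [y yA yX]] : X \proper A by rewrite properEneq XneqA XA.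
have [||u [v [uX vX euv]]] := cA' X x y.
- by rewrite inE xX (subsetP XA).
- by rewrite inE yX.
move: uX vX; rewrite !inE => /andP[uA uX] /andP[vX vA].
apply: (IHn (v |: X)).
- apply: leq_trans leX; apply: proper_card; apply/properP; split.
    by apply: setDS; apply: subsetUr.
  by exists v; rewrite !inE ?vX ?vA ?eqxx.
- exact: connU1 uX euv.
- by apply/set0Pn; exists v; rewrite setU11.
- by rewrite subUset sub1set vA.
- by apply: le_trans (NSU X v) _; lra.
Qed.

Theorem theorem4p3 (R : realType) (k : nat) :
  exists2 eps0 : R, 0 < eps0 &
  forall eps : R, 0 < eps -> eps <= eps0 ->
  forall (T : finType) (e : rel T) (A B S : {set T}),
  structured_pair eps e A B S ->
  [\/ exists P Q : {set T},
        [/\ anti_adjacent e P Q, P \subset S, Q \subset S,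
            eps * #|S|%:R <= #|P|%:R & eps * #|S|%:R <= #|Q|%:R],
      exists (l : nat) (X Y : {set T}),
        [/\ (k <= l)%N, active_hook e l X Y, Y \subset S
          & 2 * eps * #|S|%:R <= #|Y|%:R]
    | exists (S' : {set T}) (P : {set {set {x : T | x \in S'}}}),
        [/\ S' \subset S /\ #|S|%:R / 5 <= #|S'|%:R :> R,
            partition P [set: {x : T | x \in S'}] /\ (2 <= #|P|)%N,
            forall M, M \in P -> #|M|%:R <= eps * #|S|%:R,
            forall M, M \in P -> is_module (induced e S') M
          & claw_free (quotient_graph (induced e S') P)
            /\ berge (quotient_graph (induced e S') P)]].
Proof.
have k0 : 0 <= k%:R :> R by rewrite ler0n.
have den_gt0 : 0 < 100 * (k%:R + 1) :> R by lra.
(* Small enough for both [eps * (9 + 2k) <= 1] and [100 * (eps * N) <= N]. *)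
exists (100 * (k%:R + 1))^-1; first by rewrite invr_gt0.
move=> eps eps_gt0 le_eps T e A B S [].
move=> [e_sym e_irr] [A0 B0 S0] [dAB dAS dBS] _ cA cB nA nB small.
set N := #|S|%:R : R.
have N_gt0 : 0 < N by rewrite ltr0n card_gt0.
have epsk : eps * (100 * (k%:R + 1)) <= 1.
  by have := ler_wpM2r (ltW den_gt0) le_eps; rewrite mulVf // lt0r_neq0.
have epsk0 : 0 <= eps * k%:R by rewrite mulr_ge0 // ltW.
have eps_small : eps * (9 + 2 * k%:R) <= 1 by lra.
have eN : 0 < eps * N by rewrite mulr_gt0.
have eN_le : 100 * (eps * N) <= N.
  rewrite mulrA ger_pMl //; lra.
have [?|no1] := EM (exists P Q : {set T},
        [/\ anti_adjacent e P Q, P \subset S, Q \subset S,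
            eps * N <= #|P|%:R & eps * N <= #|Q|%:R]); first by constructor 1.
have [?|no2] := EM (exists (l : nat) (X Y : {set T}),
        [/\ (k <= l)%N, active_hook e l X Y, Y \subset S
          & 2 * eps * N <= #|Y|%:R]); first by constructor 2.
constructor 3.
have no_anti (P Q : {set T}) : anti_adjacent e P Q ->
    P \subset S -> Q \subset S -> eps * N <= #|P|%:R -> ~ eps * N <= #|Q|%:R.
  by move=> ? ? ? ? ?; apply: no1; exists P, Q.
have no_hook l (X Y : {set T}) : (k <= l)%N ->
    active_hook e l X Y -> Y \subset S -> ~ 2 * eps * N <= #|Y|%:R.
  by move=> ? ? ? ?; apply: no2; exists l, X, Y.
pose NS (W : {set T}) := [set s in S | [exists w in W, e w s]].
pose big (W : {set T}) : Prop := 5 * (eps * N) < #|NS W|%:R.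
have big_sub (W W' : {set T}) : W \subset W' -> big W -> big W'.
  move=> sW; rewrite /big => /lt_le_trans; apply; rewrite ler_nat subset_leq_card //.
  apply/subsetP=> s; rewrite !inE => /andP[-> /exists_inP[w wW ews]].
  by apply/exists_inP; exists w; rewrite ?(subsetP sW).
have no_link (W : {set T}) v p c d : conn e W -> big W ->
  v \notin W -> (exists2 w, w \in W & e w v) ->
  far e W p -> far e W c -> far e W d ->
  e v p -> e v c -> e c d -> ~~ e p c -> ~~ e p d -> ~~ e v d -> False.
  move=> cW bW vW exW /andP[pW /forall_inP fp] /andP[cNW /forall_inP fc].
  move=> /andP[dW /forall_inP fd] evp evc ecd npc npd nvd.
  apply: (no_linked_P4 e_sym e_irr eps_gt0 S0 eps_small small no_anti no_hook cW bW
    vW pW cNW dW evp evc ecd npc npd nvd exW) => w wW.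
  by rewrite fp ?fc ?fd.
(* Seeds dominating about [N / 10] are big, and discarding what the two dominate leaves [4N / 5]
   vertices; the largest of four parity classes then has at least [N / 5]. *)
have lt_seed : N / 10 + eps * N < N by lra.
have [XA [cXA XA0 XAs /andP[XAl XAu]]] : exists X : {set T},
    [/\ conn e X, X != set0, X \subset A & N / 10 - eps * N < #|NS X|%:R <= N / 10].
  by apply: seed_exists => //; lra.
have [XB [cXB XB0 XBs /andP[XBl XBu]]] : exists X : {set T},
    [/\ conn e X, X != set0, X \subset B & N / 10 - eps * N < #|NS X|%:R <= N / 10].
  by apply: seed_exists => //; lra.
have bigXA : big XA by rewrite /big; lra.
have bigXB : big XB by rewrite /big; lra.
have [rA [lA [sideA lA0]]] := side_exists e_sym cA nA cXA XA0 XAs bigXA.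
have [rB [lB [sideB lB0]]] := side_exists e_sym cB nB cXB XB0 XBs bigXB.
pose S1 := S :\: NS XA :\: NS XB.
have leS1 : 4 * (N / 5) <= #|S1|%:R.
  have h (X Y : {set T}) : #|X|%:R <= #|X :\: Y|%:R + #|Y|%:R :> R.
    rewrite -natrD ler_nat -(cardsID Y X) addnC leq_add2l subset_leq_card //.
    exact: subsetIr.
  have := h S (NS XA); have := h (S :\: NS XA) (NS XB); rewrite -/S1 -/N; lra.
pose cl (i j : bool) := [set x in S1 | (odd (lA x) == i) && (odd (lB x) == j)].
have [i [j leK]] : exists i j, N / 5 <= #|cl i j|%:R.
  have cU : (#|S1| <= #|cl true true| + #|cl true false| + #|cl false true| +
      #|cl false false|)%N.
    apply: leq_trans (_ : #|cl true true :|: cl true false :|: cl false true :|: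
        cl false false| <= _)%N.
      apply: subset_leq_card; apply/subsetP=> x xS.
      have : x \in cl (odd (lA x)) (odd (lB x)) by rewrite in_set xS !eqxx.
      by rewrite !in_setU; do 2![case: (odd _)] => ->; rewrite ?orbT.
    apply: leq_trans (leq_card_setU _ _) _; rewrite leq_add2r.
    apply: leq_trans (leq_card_setU _ _) _; rewrite leq_add2r.
    exact: leq_card_setU.
  move: cU; rewrite -(ler_nat R) !natrD => cU.
  case: (leP (N / 5) #|cl true true|%:R) => h1; first by exists true, true.
  case: (leP (N / 5) #|cl true false|%:R) => h2; first by exists true, false.
  case: (leP (N / 5) #|cl false true|%:R) => h3; first by exists false, true.
  exists false, false; lra.
pose K := cl i j; rewrite -/K in leK.
have KP x : x \in K -> [/\ x \in S, x \notin NS XA, x \notin NS XB,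
    odd (lA x) = i & odd (lB x) = j].
  by rewrite !in_set => /andP[/and3P[nB' nA' xS] /andP[/eqP -> /eqP ->]].
have lay : layered e S big A B rA lA rB lB K.
  split=> //.
  - move=> a b aA bB; apply/negP=> eab.
    have : b \in set_nbhd e A.
      rewrite inE; apply/andP; split; first by rewrite (disjointFl dAB).
      by apply/exists_inP; exists a; rewrite // e_sym.
    by rewrite nA (disjointFr dBS).
  - by move=> a aA; rewrite (disjointFr dAB).
  - by move=> x /KP[].
  - move=> x /KP[xS + _ _ _]; rewrite inE xS /= lt0n; apply: contraNneq.
    by move=> /(lA0 x xS)[w wX ewx]; apply/exists_inP; exists w.
  - move=> x /KP[xS _ + _ _]; rewrite inE xS /= lt0n; apply: contraNneq.
    by move=> /(lB0 x xS)[w wX ewx]; apply/exists_inP; exists w.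
  - by move=> x y /KP[_ _ _ -> _] /KP[_ _ _ -> _].
  - by move=> x y /KP[_ _ _ _ ->] /KP[_ _ _ _ ->].
pose sh := share e A rA lA.
have sh_sym : symmetric sh by apply: share_sym.
have sh_dist x y z : x \in K -> y \in K -> z \in K ->
    ~~ e x y -> sh x y -> e x z -> ~~ e y z -> sh y z.
  exact: (distinguish_share e_sym big_sub no_link lay).
have sh_alt u v w : u \in K -> v \in K -> w \in K ->
    ~~ e u v -> ~~ sh u v -> e w u -> e w v -> sh w u = ~~ sh w v.
  exact: (share_alternate e_sym e_irr big_sub no_link lay).
have part := twin_partition K e_sym sh_sym.
have KS : K \subset S by apply/subsetP=> x /KP[].
(* Members of a class have the same neighbours in [A], so the class lies in the neighbourhood of a
   single [a]. *)
have smallM M : M \in twin_classes e K sh -> #|M|%:R <= eps * N :> R.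
  move=> PM.
  have [->|[x xM]] := set_0Vmem M; first by rewrite cards0 ltW.
  have xK := valP x.
  have [a [aA exa _]] := side_ex sideA (subsetP KS _ xK).
  apply: le_trans (small a); rewrite ler_nat -(card_imset _ val_inj) subset_leq_card //.
  apply/subsetP=> _ /imsetP[y yM ->]; rewrite !inE (subsetP KS _ (valP y)) andbT.
  apply/orP; right; rewrite e_sym.
  move: yM; rewrite (twin_classE e_sym sh_sym PM xM) => /connectP[p].
  elim: p x exa {xM xK} => [|z p IHp] x exa /=; first by move=> _ ->.
  case/andP=> /and3P[_ nxz sxz] pz yl; apply: IHp pz yl.
  by rewrite -(share_nbhdA e_sym big_sub no_link lay (valP x) (valP z) nxz sxz aA).
exists K, (twin_classes e K sh); split=> //.
(* A single class would be all of [K], which has at least [N / 5 > eps * N] vertices. *)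
- split=> //; rewrite ltnNge; apply/negP=> le1.
  have cK : #|K| = (\sum_(M in twin_classes e K sh) #|M|)%N.
    by rewrite -(card_partition part) cardsT card_sig; apply: eq_card.
  have : #|K|%:R <= eps * N :> R.
    have [P0|[M PM]] := set_0Vmem (twin_classes e K sh).
      by rewrite cK P0 big_set0 ltW.
    rewrite cK (big_pred1 M) ?smallM // => M'; apply/idP/eqP => [PM'|-> //].
    by apply: (card_le1_eqP le1).
  lra.
- exact: twin_class_module.
- split; first exact: twin_quotient_claw_free.
  exact: twin_quotient_berge.
Qed.
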